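(* Let $L=(\mathfrak g\otimes F[t^{\pm2}])\oplus(\mathfrak s\otimes tF[t^{\pm2}])$ be a twisted locally loop algebra of type $\mathrm B^{(2)}_{\mathfrak I}$, $\mathrm C^{(2)}_{\mathfrak I}$ or $\mathrm{BC}^{(2)}_{\mathfrak I}$ with $\mathfrak I$ infinite. Then $(\mathrm{Der}_FL)_0^0=\mathrm{ad}\,P\oplus Fd^{(0)}$, and for all $m\in\mathbb Z$ $$(\mathrm{Der}_FL)_0^{2m}=s_{2m}\circ(\mathrm{Der}_FL)_0^0\qquad\text{and}\qquad(\mathrm{Der}_FL)_0^{2m+1}=s_{2m+1}\circ\mathrm{ad}\,T^-.$$
   Context: $F$ is a field of characteristic $0$; $\mathfrak I$ is an infinite index set. For an index set $\mathfrak K$, $T_{\mathfrak K}$ is the space of all diagonal matrices of size $\mathfrak K$ (arbitrary entries), $\mathrm{sl}_{\mathfrak K}(F)$ the Lie algebra of trace $0$ matrices of size $\mathfrak K$ with finitely many nonzero entries, $\iota$ the identity matrix. $2\mathfrak I$ is two disjoint copies of $\mathfrak I$ and $2\mathfrak I+1$ is $2\mathfrak I$ plus one index. The three types: - $\mathrm C^{(2)}_{\mathfrak I}$: $\mathfrak K=2\mathfrak I$, $\sigma(x)=sx^Ts$ with $s=\begin{pmatrix}0&-\iota\\ \iota&0\end{pmatrix}$; $\mathfrak g$ and $\mathfrak s$ are the $(+1)$- and $(-1)$-eigenspaces of $\sigma$ on $\mathrm{sl}_{2\mathfrak I}(F)$ (so $\mathfrak g=\mathrm{sp}_{2\mathfrak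 I}(F)$); $P$ and $T^-$ are the $(+1)$- and $(-1)$-eigenspaces of $\sigma$ on $T_{2\mathfrak I}$. - $\mathrm{BC}^{(2)}_{\mathfrak I}$: $\mathfrak K=2\mathfrak I+1$, $\sigma(x)=-sx^Ts$ with $s=\begin{pmatrix}0&\iota&0\\ \iota&0&0\\0&0&1\end{pmatrix}$; $\mathfrak g$ and $\mathfrak s$ are the $(+1)$- and $(-1)$-eigenspaces of $\sigma$ on $\mathrm{sl}_{2\mathfrak I+1}(F)$ (so $\mathfrak g=\mathrm o_{2\mathfrak I+1}(F)$); $P$ and $T^-$ are the $(+1)$- and $(-1)$-eigenspaces of $\sigma$ on $T_{2\mathfrak I+1}$. - $\mathrm B^{(2)}_{\mathfrak I}$: let $\mathfrak I+1=\mathfrak I\cup\{j_0\}$, $\mathfrak K=2\mathfrak I+2=2(\mathfrak I+1)$, the second copy of $j$ being denoted $-j$; $\sigma(x)=-sx^Ts$ with $s=\begin{pmatrix}0&\iota\\ \iota&0\end{pmatrix}$ (blocks of size $\mathfrak I+1$), $\mathrm o_{2\mathfrak I+2}(F)=\mathrm{sl}_{2\mathfrak I+2}(F)^\sigma$; $\tau(x)=gxg$ where $g$ is the permutation matrix interchanging $j_0$ and $-j_0$. $\mathfrak g$ ($\cong\mathrm o_{2\mathfrak I+1}(F)$) and $\mathfrak s$ are the $(+1)$- and $(-1)$-eigenspaces of $\tau$ on $\mathrm o_{2\mathfrak I+2}(F)$; $P=\{x\in T_{2\mathfrak I+2}:\sigma(x)=x,\tau(x)=x\}$; $T^-=\mathfrak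 s_0:=F(e_{j_0,j_0}-e_{-j_0,-j_0})$. In all cases the bracket of $L$ is $[x\otimes t^m,y\otimes t^n]=[x,y]\otimes t^{m+n}$. Let $\mathfrak h$ be the set of diagonal matrices in $\mathfrak g$, $\Delta$ the set of nonzero weights of $\mathfrak h$ on $\mathfrak g\oplus\mathfrak s$, and $L_\alpha^k$ ($\alpha\in\Delta$, $k\in\mathbb Z$) the space $\mathfrak g_\alpha\otimes t^k$ for $k$ even, $\mathfrak s_\alpha\otimes t^k$ for $k$ odd, where $\mathfrak g_\alpha,\mathfrak s_\alpha$ are the weight spaces (possibly zero). For $n\in\mathbb Z$, $$(\mathrm{Der}_FL)_0^n=\{d\in\mathrm{Der}_FL: d(L_\alpha^k)\subset L_\alpha^{k+n}\text{ for all }\alpha\in\Delta,\ k\in\mathbb Z\}.$$ For a diagonal matrix $p$, $\mathrm{ad}\,p$ acts by $x\otimes t^k\mapsto[p,x]\otimes t^k$; $d^{(0)}=t\frac{d}{dt}$ acts by $x\otimes t^k\mapsto k\,x\otimes t^k$; $s_n$ is the shift $x\otimes t^k\mapsto x\otimes t^{k+n}$ (so $s_{2m+1}\circ\mathrm{ad}\,p$ is $x\otimes t^k\mapsto[p,x]\otimes t^{k+2m+1}$). *)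

(* Defs.v *)
From HB Require Import structures.
From mathcomp Require Import all_boot all_order all_algebra zify ring.
From mathcomp Require Import finmap.
From mathcomp Require Import boolp classical_sets functions cardinality fsbigop.

Set Implicit Arguments.
Unset Strict Implicit.
Unset Printing Implicit Defensive.

Import Order.TTheory GRing.Theory Num.Theory.
Local Open Scope classical_set_scope.
Local Open Scope ring_scope.

(* Matrices of size K, for a possibly infinite index set K.  The codomain is
   F^o so that the pointwise F-module structure is inferred. *)
Definition mat (F : fieldType) (K : choiceType) := K -> K -> F^o.
HB.instance Definition _ F K := GRing.Lmodule.copy (mat F K) (K -> K -> F^o).

Section Matrices.
Variables (F : fieldType) (K : choiceType).
Implicit Types x y : mat F K.

(* Sums over [set: K] are finitely supported sums (0 by convention if the
   support is infinite).  Below, one factor of every product is row- and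
   column-finite, so that the sums really are finite. *)
Definition mmul x y : mat F K :=
  fun i j => \sum_(k \in [set: K]) (x i k * y k j : F).

Definition mtr x : F := \sum_(i \in [set: K]) (x i i : F).

Definition mtrans x : mat F K := fun i j => x j i.

Definition munit (i0 j0 : K) : mat F K := fun i j => ((i == i0) && (j == j0))%:R.

Definition brack x y : mat F K := mmul x y - mmul y x.

Definition diagonal x := forall i j, i != j -> x i j = 0.

Definition sl : set (mat F K) :=
  [set x | finite_set [set ij : K * K | x ij.1 ij.2 != 0] /\ mtr x = 0].

End Matrices.

Lemma fsumN (V : zmodType) (K : choiceType) (f : K -> V) :
  \sum_(k \in [set: K]) (- f k) = - \sum_(k \in [set: K]) f k.
Proof.
have e : (fun k => - f k) @^-1` [set~ 0] = f @^-1` [set~ 0].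
  apply/seteqP; split=> k /= h e; apply: h; move: e.
    by move=> ->; rewrite oppr0.
  by move/eqP; rewrite oppr_eq0 => /eqP.
rewrite /finite_support e.
by rewrite -sumrN.
Qed.

Section MatrixLemmas.
Variables (F : fieldType) (K : choiceType).
Implicit Types x y : mat F K.

Lemma mmulNl x y : mmul (- x) y = - mmul x y.
Proof.
apply/funext => i; apply/funext => j; rewrite /mmul.
apply: etrans (fsumN (fun k => x i k * y k j : F)).
by apply: eq_fsbigr => k _; exact: mulNr.
Qed.

Lemma mmulNr x y : mmul x (- y) = - mmul x y.
Proof.
apply/funext => i; apply/funext => j; rewrite /mmul.
apply: etrans (fsumN (fun k => x i k * y k j : F)).
by apply: eq_fsbigr => k _; exact: mulrN.
Qed.

Lemma brackNl x y : brack (- x) y = - brack x y.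
Proof. by rewrite /brack mmulNl mmulNr opprD. Qed.

Lemma brackNr x y : brack x (- y) = - brack x y.
Proof. by rewrite /brack mmulNl mmulNr opprD. Qed.

Lemma mmul0l x : mmul 0 x = 0.
Proof.
apply/funext => i; apply/funext => j; apply: fsbig1 => k _; exact: mul0r.
Qed.

Lemma mmul0r x : mmul x 0 = 0.
Proof.
apply/funext => i; apply/funext => j; apply: fsbig1 => k _; exact: mulr0.
Qed.

Lemma brack0l x : brack 0 x = 0.
Proof. by rewrite /brack mmul0l mmul0r subr0. Qed.

Lemma brack0r x : brack x 0 = 0.
Proof. by rewrite /brack mmul0l mmul0r subr0. Qed.

Definition msupp x := [set ij : K * K | x ij.1 ij.2 != 0].

(* A finite set of indices outside of which all rows and columns vanish. *)
Lemma finite_box x : finite_set (msupp x) ->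
  exists A : {fset K}, forall i j, (i \notin A) || (j \notin A) -> x i j = 0.
Proof.
move=> fx.
have f1 : finite_set ((fst @` msupp x) `|` (snd @` msupp x)).
  by rewrite finite_setU; split; apply: finite_image.
exists (fset_set ((fst @` msupp x) `|` (snd @` msupp x))) => i j h.
apply/eqP; apply: contraT => nz; move: h.
have iA : i \in fset_set ((fst @` msupp x) `|` (snd @` msupp x)).
  by rewrite in_fset_set //; apply/mem_set; left; exists (i, j).
have jA : j \in fset_set ((fst @` msupp x) `|` (snd @` msupp x)).
  by rewrite in_fset_set //; apply/mem_set; right; exists (i, j).
by rewrite iA jA.
Qed.

Lemma box_finite (A : {fset K}) x :
  (forall i j, (i \notin A) || (j \notin A) -> x i j = 0) ->
  finite_set (msupp x).
Proof.
move=> h; apply: (@sub_finite_set _ _ ([set` A] `*` [set` A])).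
  move=> [i j] /= nz; split=> /=.
    by apply: contraNT nz => iA; rewrite h ?iA.
  by apply: contraNT nz => jA; rewrite h ?jA ?orbT.
exact: finite_setX.
Qed.

Lemma finite_box2 x y : finite_set (msupp x) -> finite_set (msupp y) ->
  exists A : {fset K}, forall i j, (i \notin A) || (j \notin A) ->
    x i j = 0 /\ y i j = 0.
Proof.
move=> /finite_box [A hA] /finite_box [B hB].
exists (A `|` B)%fset => i j; rewrite !in_fsetU !negb_or.
by case/orP=> /andP[a b]; split; [apply: hA|apply: hB|apply: hA|apply: hB];
  rewrite ?a ?b ?orbT.
Qed.

Lemma box_mmul (A : {fset K}) x y :
  (forall i j, (i \notin A) || (j \notin A) -> x i j = 0 /\ y i j = 0) ->
  forall i j, mmul x y i j = \sum_(k <- A) (x i k * y k j : F).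
Proof.
move=> h i j; rewrite /mmul; apply: fsbigTE => k kA.
by have [-> _] := h i k (introT orP (or_intror kA)); rewrite mul0r.
Qed.

Lemma box_mtr (A : {fset K}) x :
  (forall i j, (i \notin A) || (j \notin A) -> x i j = 0) ->
  mtr x = \sum_(k <- A) (x k k : F).
Proof. by move=> h; apply: fsbigTE => k kA; rewrite h ?kA. Qed.

Lemma sl_brack x y : sl x -> sl y -> sl (brack x y).
Proof.
move=> [fx _] [fy _]; have [A hA] := finite_box2 fx fy.
have hA' i j : (i \notin A) || (j \notin A) -> y i j = 0 /\ x i j = 0.
  by move=> /hA [].
have bE i j : brack x y i j =
    \sum_(k <- A) (x i k * y k j : F) - \sum_(k <- A) (y i k * x k j : F).
  by rewrite -(box_mmul hA) -(box_mmul hA').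
have b0 i j : (i \notin A) || (j \notin A) -> brack x y i j = 0.
  move=> h; rewrite bE !big1 ?subr0 // => k _; case/orP: h => h.
  - by have [_ ->] := hA i k (introT orP (or_introl h)); rewrite mul0r.
  - by have [-> _] := hA k j (introT orP (or_intror h)); rewrite mulr0.
  - by have [-> _] := hA i k (introT orP (or_introl h)); rewrite mul0r.
  - by have [_ ->] := hA k j (introT orP (or_intror h)); rewrite mulr0.
split; first exact: box_finite b0.
rewrite (box_mtr b0); under eq_bigr do rewrite bE.
rewrite sumrB [X in _ - X]exchange_big /=.
apply/eqP; rewrite subr_eq0; apply/eqP.
by apply: eq_bigr => i _; apply: eq_bigr => j _; rewrite mulrC.
Qed.

Lemma sl_submod : submod_closed (fun x => `[< @sl F K x >]).
Proof.
split; first apply/asboolP; first split.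
- by rewrite (_ : [set _ | _] = set0) //; apply/seteqP; split=> // ij /=;
    rewrite eqxx.
- by apply: fsbig1 => i _.
move=> a x y /asboolP [fx tx] /asboolP [fy ty]; apply/asboolP.
have [A hA] := finite_box2 fx fy.
have h0 i j : (i \notin A) || (j \notin A) -> (a *: x + y) i j = 0.
  by move=> /hA [ex ey]; rewrite -[LHS]/(a * x i j + y i j : F) ex ey
    mulr0 addr0.
split; first exact: box_finite h0.
rewrite (box_mtr h0).
rewrite (box_mtr (A := A)) in tx; last by move=> i j /hA [].
rewrite (box_mtr (A := A)) in ty; last by move=> i j /hA [].
transitivity (a * \sum_(k <- A) (x k k : F) + \sum_(k <- A) (y k k : F)).
  by rewrite mulr_sumr -big_split.
by rewrite tx ty mulr0 addr0.
Qed.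

End MatrixLemmas.

(* A Lie algebra of matrices with an automorphism theta (an involution in all
   the cases considered); fixp and antip are its (+1)- and (-1)-eigenspaces. *)
Record symm_pair (F : fieldType) (K : choiceType) := SymmPair {
  alg : set (mat F K);
  theta : mat F K -> mat F K;
  alg_submod : submod_closed (fun x => `[< alg x >]);
  alg_brack : forall x y, alg x -> alg y -> alg (brack x y);
  theta_linear : linear theta;
  theta_brack : forall x y, theta (brack x y) = brack (theta x) (theta y) }.

(* The element sum_k x_k (x) t^k is the function k |-> x_k. *)
Definition loop (F : fieldType) (K : choiceType) := int -> mat F K.
HB.instance Definition _ F K := GRing.Lmodule.copy (loop F K) (int -> mat F K).

Section Loops.
Variables (F : fieldType) (K : choiceType).
Implicit Types (X Y : loop F K) (p x : mat F K).

Definition tens x (k : int) : loop F K := fun n => if n == k then x else 0.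

Definition loop_brack X Y : loop F K :=
  fun n => \sum_(k \in [set: int]) brack (X k) (Y (n - k)).

Definition loop_ad p X : loop F K := fun k => brack p (X k).

Definition loop_deg X : loop F K := fun k => k%:~R *: X k.

Definition loop_shift (n : int) X : loop F K := fun k => X (k - n).

End Loops.

Section TwistedLoop.
Variables (F : fieldType) (K : choiceType) (S : symm_pair F K).

Definition fixp : set (mat F K) := [set x | alg S x /\ theta S x = x].
Definition antip : set (mat F K) := [set x | alg S x /\ theta S x = - x].
Definition part (k : int) : set (mat F K) := if (2 %| k)%Z then fixp else antip.

Definition twisted_loop_pred : {pred loop F K} := fun X =>
  `[< finite_set [set k | X k != 0] /\ forall k, part k (X k) >].

Lemma part_submod k : submod_closed (fun x => `[< part k x >]).
Proof.
have [a0 aD] := alg_submod S; have tl := theta_linear S.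
have t0 : theta S 0 = 0.
  by have := tl (- 1) 0 0; rewrite scaler0 addr0 scaleN1r addNr.
move/asboolP: a0 => a0; rewrite /part.
case: ifP => _; split; first by apply/asboolP.
- move=> c x y /asboolP[ax ex] /asboolP[ay ey]; apply/asboolP; split.
    by apply/asboolP; apply: aD; apply/asboolP.
  by rewrite tl ex ey.
- by apply/asboolP; split=> //; rewrite t0 oppr0.
- move=> c x y /asboolP[ax ex] /asboolP[ay ey]; apply/asboolP; split.
    by apply/asboolP; apply: aD; apply/asboolP.
  by rewrite tl ex ey scalerN opprD.
Qed.

Lemma part0 k : part k 0.
Proof. by have [/asboolP] := part_submod k. Qed.

Lemma partZD k c x y : part k x -> part k y -> part k (c *: x + y).
Proof.
by move=> px py; have [_ h] := part_submod k; apply/asboolP/h; apply/asboolP.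
Qed.

Lemma part_brack k l x y : part k x -> part l y -> part (k + l) (brack x y).
Proof.
have : (2 %| k + l)%Z = ((2 %| k)%Z == (2 %| l)%Z) by lia.
rewrite /part => ->.
case: ifP => _; case: ifP => _ /= [ax ex] [ay ey];
  (split; first exact: alg_brack);
  by rewrite theta_brack ex ey ?brackNl ?brackNr ?opprK.
Qed.

Lemma twisted_loop_submod : submod_closed twisted_loop_pred.
Proof.
split.
  apply/asboolP; split=> [|k]; last exact: part0.
  by apply: sub_finite_set (@finite_set0 int) => k /=; rewrite eqxx.
move=> c X Y /asboolP[fX pX] /asboolP[fY pY]; apply/asboolP; split=> [|k].
  have fXY : finite_set ([set k | X k != 0] `|` [set k | Y k != 0]).
    by rewrite finite_setU.
  apply: sub_finite_set fXY => k /= nz.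
  case: (eqVneq (X k) 0) => [eX|]; last by left.
  right; apply: contraNneq nz => eY.
  by apply/eqP; rewrite -[LHS]/(c *: X k + Y k) eX eY scaler0 addr0.
exact: partZD.
Qed.

HB.instance Definition _ :=
  GRing.isSubmodClosed.Build F (loop F K) twisted_loop_pred twisted_loop_submod.

(* L = (g (x) F[t^{+-2}]) (+) (s (x) t F[t^{+-2}]), where g = fixp, s = antip. *)
Record twisted_loop := TwistedLoop {
  loop_val :> loop F K;
  loop_valP : loop_val \in twisted_loop_pred }.

HB.instance Definition _ := [isSub for loop_val].
HB.instance Definition _ := [Choice of twisted_loop by <:].
HB.instance Definition _ := [SubChoice_isSubLmodule of twisted_loop by <:].

Lemma loop_brackP (X Y : twisted_loop) : loop_brack X Y \in twisted_loop_pred.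
Proof.
case: X Y => [X /= /asboolP[fX pX]] [Y /= /asboolP[fY pY]].
have XE n : loop_brack X Y n =
    \sum_(k <- fset_set [set k | X k != 0]) brack (X k) (Y (n - k)).
  rewrite /loop_brack; apply: fsbigTE => k; rewrite in_fset_set // notin_setE /=.
  by move=> /negP; rewrite negbK => /eqP ->; rewrite brack0l.
apply/asboolP; split=> [|n].
  have f2 := finite_image2 (fun k l : int => k + l) fX fY.
  apply: sub_finite_set f2 => n /= nz.
  apply: contrapT => h; move/eqP: nz; apply; rewrite XE big1_seq // => k /=.
  rewrite in_fset_set // => /set_mem /= Xk.
  case: (eqVneq (Y (n - k)) 0) => [->|Yk]; first exact: brack0r.
  by exfalso; apply: h; exists k => //; exists (n - k) => //; rewrite addrC subrK.
rewrite XE; elim/big_rec: _ => [|k x _ px]; first exact: part0.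
rewrite -[brack _ _]scale1r; apply: partZD => //.
by have := part_brack (pX k) (pY (n - k)); rewrite addrC subrK.
Qed.

Definition Lbrack (X Y : twisted_loop) : twisted_loop :=
  TwistedLoop (loop_brackP X Y).

Definition Der : set (twisted_loop -> twisted_loop) :=
  [set d | linear d /\
    forall X Y, d (Lbrack X Y) = Lbrack (d X) Y + Lbrack X (d Y)].

Definition cartan : set (mat F K) := [set x | fixp x /\ diagonal x].

Definition wt_space (V : set (mat F K)) (alpha : cartan -> F) : set (mat F K) :=
  [set x | V x /\ forall h : cartan, brack (\val h) x = alpha h *: x].

(* Linearity of a weight is not required: it is automatic when the weight
   space is nonzero. *)
Definition Delta : set (cartan -> F) :=
  [set alpha | (exists h, alpha h != 0) /\
    exists2 x, wt_space [set y + z | y in fixp & z in antip] alpha x & x != 0].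

Definition root_space (alpha : cartan -> F) (k : int) : set twisted_loop :=
  [set X | exists2 x, wt_space (part k) alpha x & X = tens x k :> loop F K].

Definition Der0 (n : int) : set (twisted_loop -> twisted_loop) :=
  [set d | Der d /\
    forall alpha k, Delta alpha -> d @` root_space alpha k `<=`
                                   root_space alpha (k + n)].

(* Operators such as shifts by odd degrees are defined on all loops but do not
   preserve L, so that maps L -> L are compared as maps from L to loops. *)
Definition on_L (D : loop F K -> loop F K) : twisted_loop -> loop F K :=
  fun X => D X.

Definition DerL (n : int) : set (twisted_loop -> loop F K) :=
  [set (fun X => loop_val (d X)) | d in Der0 n].

End TwistedLoop.

Arguments on_L {F K} S D.
Arguments DerL {F K} S n.

Inductive twisted_type := B2 | C2 | BC2.

Section Types.
Variables (F : fieldType) (I : choiceType).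

(* inl i and inr i are the two copies of i.  The additional index is None;
   in type B2, it is added to I before doubling. *)
Definition tw_index (ty : twisted_type) : choiceType :=
  match ty with
  | B2 => (option I + option I)%type
  | C2 => (I + I)%type
  | BC2 => option (I + I)
  end.

Definition formB : mat F (tw_index B2) := fun i j =>
  match i, j with
  | inl i, inr j | inr i, inl j => (i == j)%:R
  | _, _ => 0
  end.

Definition formC : mat F (tw_index C2) := fun i j =>
  match i, j with
  | inl i, inr j => - (i == j)%:R
  | inr i, inl j => (i == j)%:R
  | _, _ => 0
  end.

Definition formBC : mat F (tw_index BC2) := fun i j =>
  match i, j with
  | Some (inl i), Some (inr j) | Some (inr i), Some (inl j) => (i == j)%:R
  | None, None => 1
  | _, _ => 0
  end.

Definition sigma (ty : twisted_type) : mat F (tw_index ty) -> mat F (tw_index ty) :=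
  match ty with
  | B2 => fun x => - mmul (mmul formB (mtrans x)) formB
  | C2 => fun x => mmul (mmul formC (mtrans x)) formC
  | BC2 => fun x => - mmul (mmul formBC (mtrans x)) formBC
  end.

(* The indices j_0 and - j_0 of type B2. *)
Definition j0 : tw_index B2 := inl None.
Definition j0' : tw_index B2 := inr None.

Definition swap_j0 (i : tw_index B2) : tw_index B2 :=
  if i == j0 then j0' else if i == j0' then j0 else i.

Definition permB : mat F (tw_index B2) := fun i j => (i == swap_j0 j)%:R.

Definition tau (x : mat F (tw_index B2)) : mat F (tw_index B2) :=
  mmul (mmul permB x) permB.

Definition o_even : set (mat F (tw_index B2)) :=
  [set x | sl x /\ sigma (ty := B2) x = x].

(* Automorphisms given by signed permutations of the indices. *)
Section Signed.
Variables (K : choiceType) (pi : K -> K) (eta : K -> F).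
Hypotheses (piK : involutive pi) (etaK : forall i, eta i * eta i = 1).
Variable s : mat F K.
Hypothesis sE : forall i j, s i j = eta i * (i == pi j)%:R.

Lemma fsum_single (f : K -> F) (a : K) : (forall k, k != a -> f k = 0) ->
  \sum_(k \in [set: K]) f k = f a.
Proof.
move=> h; rewrite (fsbigTE [fset a]%fset) ?big_seq_fset1 // => k.
by rewrite in_fset1 => /h.
Qed.

Lemma sandwichE (x : mat F K) i j :
  mmul (mmul s x) s i j = eta i * eta (pi j) * x (pi i) (pi j).
Proof.
rewrite /mmul (@fsum_single _ (pi j)); last first.
  by move=> k /negPf kj; rewrite sE kj !mulr0.
rewrite (@fsum_single _ (pi i)); last first.
  move=> k ki; rewrite sE (_ : (i == pi k) = false) ?mulr0 ?mul0r //.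
  by apply: contraNF ki => /eqP ->; rewrite piK.
by rewrite !sE piK !eqxx !mulr1 mulrAC.
Qed.

Variable th : mat F K -> mat F K.

Lemma anti_linear :
  (forall x i j, th x i j = - (eta i * eta j * x (pi j) (pi i))) -> linear th.
Proof.
move=> h a x y; apply/funext => i; apply/funext => j.
rewrite -[RHS]/(a * th x i j + th y i j : F) !h.
rewrite -[(a *: x + y) _ _]/(a * x (pi j) (pi i) + y (pi j) (pi i) : F).
by rewrite mulrDr opprD mulrN mulrCA.
Qed.

Lemma anti_brack :
  (forall x i j, th x i j = - (eta i * eta j * x (pi j) (pi i))) ->
  forall x y, th (brack x y) = brack (th x) (th y).
Proof.
move=> h x y; apply/funext => i; apply/funext => j.
have mE (u v : mat F K) :
    mmul (th u) (th v) i j = eta i * eta j * mmul v u (pi j) (pi i).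
  rewrite /mmul (reindex_fsbigT pi) /=; last by exists pi.
  have key (a b c p q : F) :
      - (a * c * p) * - (c * b * q) = a * b * (c * c) * (q * p) by ring.
  rewrite mulr_fsumr; apply: eq_fsbigr => k _; rewrite !h piK.
  by rewrite [LHS]key etaK mulr1.
rewrite h -[brack x y _ _]/(mmul x y (pi j) (pi i) - mmul y x (pi j) (pi i) : F).
rewrite -[RHS]/(mmul (th x) (th y) i j - mmul (th y) (th x) i j : F) !mE.
by rewrite -mulrBr -mulrN opprB.
Qed.

Lemma perm_linear :
  (forall x i j, th x i j = x (pi i) (pi j)) -> linear th.
Proof.
move=> h a x y; apply/funext => i; apply/funext => j.
by rewrite -[RHS]/(a * th x i j + th y i j : F) !h.
Qed.

Lemma perm_brack :
  (forall x i j, th x i j = x (pi i) (pi j)) ->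
  forall x y, th (brack x y) = brack (th x) (th y).
Proof.
move=> h x y; apply/funext => i; apply/funext => j.
have mE (u v : mat F K) : mmul (th u) (th v) i j = mmul u v (pi i) (pi j).
  rewrite /mmul (reindex_fsbigT pi) /=; last by exists pi.
  by apply: eq_fsbigr => k _; rewrite !h piK.
rewrite h -[RHS]/(mmul (th x) (th y) i j - mmul (th y) (th x) i j : F).
by rewrite !mE.
Qed.

End Signed.

Definition opp_sum (T : Type) (i : T + T) : T + T :=
  match i with inl i => inr i | inr i => inl i end.

Definition opp_index (ty : twisted_type) : tw_index ty -> tw_index ty :=
  match ty with
  | B2 => @opp_sum (option I)
  | C2 => @opp_sum I
  | BC2 => omap (@opp_sum I)
  end.

Definition sgn_index (ty : twisted_type) : tw_index ty -> F :=
  match ty with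
  | C2 => fun i => if i is inl _ then - 1 else 1
  | _ => fun=> 1
  end.

Lemma opp_indexK ty : involutive (@opp_index ty).
Proof. by case: ty => [[]|[]|[[]|]]. Qed.

Lemma sgn_indexK ty (i : tw_index ty) : sgn_index i * sgn_index i = 1.
Proof. by case: ty i => [i|[]i|i] /=; rewrite ?mulrNN mulr1. Qed.

Lemma sigmaE ty (x : mat F (tw_index ty)) i j :
  sigma x i j = - (sgn_index i * sgn_index j *
    x (opp_index j) (opp_index i)).
Proof.
case: ty x i j => x i j; rewrite /sigma.
- rewrite -[LHS]/(- (mmul (mmul formB (mtrans x)) formB i j) : F).
  rewrite (@sandwichE _ _ (@sgn_index B2) (@opp_indexK B2)) //.
  by move=> [a|a] [b|b]; rewrite /= ?mul1r /eq_op /= ?mulr0.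
- rewrite (@sandwichE _ _ (@sgn_index C2) (@opp_indexK C2)) //.
    by case: j => j /=; rewrite ?(mulrN, mulNr, mulr1, opprK).
  by move=> [a|a] [b|b]; rewrite /= ?mul1r ?mulN1r /eq_op /= ?oppr0.
- rewrite -[LHS]/(- (mmul (mmul formBC (mtrans x)) formBC i j) : F).
  rewrite (@sandwichE _ _ (@sgn_index BC2) (@opp_indexK BC2)) //.
  by move=> [[a|a]|] [[b|b]|]; rewrite /= ?mul1r /eq_op.
Qed.

Lemma sigma_linear ty : linear (@sigma ty).
Proof. exact: anti_linear (@sigmaE ty). Qed.

Lemma sigma_brack ty x y : @sigma ty (brack x y) = brack (sigma x) (sigma y).
Proof. exact: (anti_brack (@opp_indexK ty) (@sgn_indexK ty) (@sigmaE ty)). Qed.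

Lemma swap_j0K : involutive swap_j0.
Proof. by move=> [[i|]|[i|]]. Qed.

Lemma tauE x i j : tau x i j = x (swap_j0 i) (swap_j0 j).
Proof.
rewrite /tau (@sandwichE _ _ (fun=> 1) swap_j0K) ?mul1r //.
by move=> *; rewrite mul1r.
Qed.

Lemma tau_linear : linear tau.
Proof. exact: perm_linear tauE. Qed.

Lemma tau_brack x y : tau (brack x y) = brack (tau x) (tau y).
Proof. exact: (perm_brack swap_j0K tauE). Qed.

Lemma o_even_submod : submod_closed (fun x => `[< o_even x >]).
Proof.
have [/asboolP s0 sD] := @sl_submod F (tw_index B2).
split.
  apply/asboolP; split=> //; apply/funext => i; apply/funext => j.
  by rewrite sigmaE [X in _ * X](_ : _ = 0) // mulr0 oppr0.
move=> a x y /asboolP[sx ex] /asboolP[sy ey]; apply/asboolP; split.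
  by apply/asboolP; apply: sD; apply/asboolP.
by rewrite sigma_linear ex ey.
Qed.

Lemma o_even_brack x y : o_even x -> o_even y -> o_even (brack x y).
Proof.
by move=> [sx ex] [sy ey]; split; [exact: sl_brack|rewrite sigma_brack ex ey].
Qed.

Definition sl_pair (ty : twisted_type) : symm_pair F (tw_index ty) :=
  @SymmPair F (tw_index ty) (@sl F (tw_index ty)) (@sigma ty)
    (@sl_submod F (tw_index ty)) (@sl_brack F (tw_index ty))
    (@sigma_linear ty) (@sigma_brack ty).

Definition o_pair : symm_pair F (tw_index B2) :=
  @SymmPair F (tw_index B2) o_even tau
    o_even_submod o_even_brack tau_linear tau_brack.

Definition twisted_pair (ty : twisted_type) : symm_pair F (tw_index ty) :=
  match ty with
  | B2 => o_pair
  | C2 => sl_pair C2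
  | BC2 => sl_pair BC2
  end.

Definition Pdiag (ty : twisted_type) : set (mat F (tw_index ty)) :=
  match ty with
  | B2 => [set x | [/\ diagonal x, @sigma B2 x = x & tau x = x]]
  | C2 => [set x | diagonal x /\ @sigma C2 x = x]
  | BC2 => [set x | diagonal x /\ @sigma BC2 x = x]
  end.

Definition Tminus (ty : twisted_type) : set (mat F (tw_index ty)) :=
  match ty with
  | B2 => [set c *: (munit F j0 j0 - munit F j0' j0') | c in [set: F]]
  | C2 => [set x | diagonal x /\ @sigma C2 x = - x]
  | BC2 => [set x | diagonal x /\ @sigma BC2 x = - x]
  end.

End Types.

Arguments Pdiag F I ty : clear implicits.
Arguments Tminus F I ty : clear implicits.

(* Main.v *)
Require Import Defs.
From mathcomp Require Import all_boot all_order all_algebra zify ring.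
From mathcomp Require Import finmap.
From mathcomp Require Import boolp classical_sets functions cardinality fsbigop.

Set Implicit Arguments.
Unset Strict Implicit.
Unset Printing Implicit Defensive.

Import GRing.Theory Num.Theory.
Local Open Scope classical_set_scope.
Local Open Scope ring_scope.

(* A derivation d of degree n is determined by its values on the root vectors
   of weight different from 0, because these generate L (as I is infinite, an
   index unrelated to any given finite set of indices is always available).
   On each one-dimensional root space d is multiplication by a scalar
   c(i, j, k) followed by the shift, where i, j are the indices of a matrix unit
   and k is the power of t.  In the types C and BC the brackets give
   c(i, j, k + m) = c(i, l, k) + c(l, j, m), hence c(i, j, k) = p_i - p_j + a k;
   the symmetry under sigma gives p_(-i) = - p_i if n is even, and
   p_(-i) = p_i, a = 0 if n is odd.  In type B the vectors of weight eps_i alone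
   generate L, and their scalars c(i, k) satisfy
   c(i, k + m + q) = c(i, k) + c(-l, m) + c(l, q) for k + m and n even, and
   c(i, k) = c(l, m) for k + m and n odd. *)

(* classical_sets has another [diagonal]. *)
Local Notation diagonal := Defs.diagonal.

(** * Finitely supported matrices *)

Section FiniteMatrices.
Variables (F : fieldType) (K : choiceType).
Implicit Types (p x y z : mat F K) (a b c d i j k l : K).

(** Infinite sums are 0 by convention, so [brack] is bilinear only on finitely supported matrices,
    whereas the diagonal matrices in P and T^- may have infinite support. These are kept out of the
    bilinear rules: they act entrywise, multiplying the entry at (i, j) by [p i i - p j j]. The
    weight 0 does not belong to [Delta], so nothing is assumed about d there, and its values must
    come from brackets. In C and BC the pairs (i, -i) get no scalar either, because the symmetrised
    matrix unit vanishes in one parity of the degree. In type B the vectors of weight eps_i - eps_l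
    and eps_i + eps_l exist in even degrees only, so pairs of indices cannot carry scalars in all
    degrees; the short weights are the only nonzero ones occurring in both parities. Two short
    vectors bracket to a multiple of s + t, where s and t are the signs of their degrees. A nonzero
    s + t gives the relation for even n, and s + t = 0 the one for odd n. *)

Definition fin x := finite_set (msupp x).

Lemma mat_ext x y : (forall i j, x i j = y i j) -> x = y.
Proof. by move=> h; apply/funext => i; apply/funext => j. Qed.

Lemma fin0 : fin 0.
Proof. by apply: sub_finite_set (@finite_set0 (K * K)) => ij /eqP; apply. Qed.

Lemma fin_munit a b : fin (munit F a b).
Proof.
apply: (box_finite (A := [fset a; b]%fset)) => i j.
rewrite !in_fset2 !negb_or /munit.
by case/orP => /andP[/negPf h1 /negPf h2]; rewrite ?h1 ?h2 ?andbF.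
Qed.

Lemma finZD (e : F) x y : fin x -> fin y -> fin (e *: x + y).
Proof.
move=> fx fy; have [A hA] := finite_box2 fx fy; apply: (box_finite (A := A)).
move=> i j /hA[ex ey].
by rewrite -[LHS]/(e * x i j + y i j : F) ex ey mulr0 addr0.
Qed.

Lemma finD x y : fin x -> fin y -> fin (x + y).
Proof. by rewrite -{2}[x]scale1r; exact: finZD. Qed.

Lemma finZ (e : F) x : fin x -> fin (e *: x).
Proof. by move=> fx; rewrite -[_ *: _]addr0; apply: finZD (fin0). Qed.

Lemma finN x : fin x -> fin (- x).
Proof. by rewrite -scaleN1r; exact: finZ. Qed.

(** A common finite box for [x] and [y] turns all three products into sums over one finite set.
    Without it the zero convention breaks additivity: two infinite rows may add up to a finite
    one. *)
Lemma mmulZDl (e : F) x y z : fin x -> fin y ->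
  mmul (e *: x + y) z = e *: mmul x z + mmul y z.
Proof.
move=> fx fy; have [A hA] := finite_box2 fx fy.
have h u : (forall i j, (i \notin A) || (j \notin A) -> u i j = 0) ->
    forall i j, mmul u z i j = \sum_(k <- A) (u i k * z k j : F).
  move=> h i j; apply: fsbigTE => k kA.
  by rewrite h ?kA ?orbT // mul0r.
apply: mat_ext => i j.
rewrite -[RHS]/(e * mmul x z i j + mmul y z i j : F).
rewrite !h ?mulr_sumr -?big_split /=.
- by apply: eq_bigr => k _; rewrite mulrA -mulrDl.
- by move=> ? ? /hA[].
- by move=> ? ? /hA[].
- by move=> a b /hA[ea eb]; rewrite -[LHS]/(e * x a b + y a b : F) ea eb
    mulr0 addr0.
Qed.

Lemma mmulZDr (e : F) x y z : fin x -> fin y ->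
  mmul z (e *: x + y) = e *: mmul z x + mmul z y.
Proof.
move=> fx fy; have [A hA] := finite_box2 fx fy.
have h u : (forall i j, (i \notin A) || (j \notin A) -> u i j = 0) ->
    forall i j, mmul z u i j = \sum_(k <- A) (z i k * u k j : F).
  move=> h i j; apply: fsbigTE => k kA.
  by rewrite [u k j]h ?kA ?orbT // mulr0.
apply: mat_ext => i j.
rewrite -[RHS]/(e * mmul z x i j + mmul z y i j : F).
rewrite !h ?mulr_sumr -?big_split /=.
- by apply: eq_bigr => k _; rewrite mulrCA -mulrDr.
- by move=> ? ? /hA[].
- by move=> ? ? /hA[].
- by move=> a b /hA[ea eb]; rewrite -[LHS]/(e * x a b + y a b : F) ea eb
    mulr0 addr0.
Qed.

Lemma brackZDl (e : F) x y z : fin x -> fin y ->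
  brack (e *: x + y) z = e *: brack x z + brack y z.
Proof.
by move=> fx fy; rewrite /brack mmulZDl // mmulZDr // scalerBr opprD addrACA.
Qed.

Lemma brackZDr (e : F) x y z : fin x -> fin y ->
  brack z (e *: x + y) = e *: brack z x + brack z y.
Proof.
by move=> fx fy; rewrite /brack mmulZDl // mmulZDr // scalerBr opprD addrACA.
Qed.

Lemma brackDl x y z : fin x -> fin y -> brack (x + y) z = brack x z + brack y z.
Proof. by move=> fx fy; rewrite -[x in LHS]scale1r brackZDl // scale1r. Qed.

Lemma brackDr x y z : fin x -> fin y -> brack z (x + y) = brack z x + brack z y.
Proof. by move=> fx fy; rewrite -[x in LHS]scale1r brackZDr // scale1r. Qed.

Lemma brackZl (e : F) x z : fin x -> brack (e *: x) z = e *: brack x z.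
Proof.
move=> fx; rewrite -[e *: x]addr0 brackZDl //; last exact: fin0.
by rewrite brack0l addr0.
Qed.

Lemma brackZr (e : F) x z : fin x -> brack z (e *: x) = e *: brack z x.
Proof.
move=> fx; rewrite -[e *: x]addr0 brackZDr //; last exact: fin0.
by rewrite brack0r addr0.
Qed.

Lemma mmul_munit a b c d :
  mmul (munit F a b) (munit F c d) = (b == c)%:R *: munit F a d.
Proof.
apply: mat_ext => i j; rewrite /mmul (@fsum_single _ _ _ b).
  rewrite -[RHS]/((b == c)%:R * ((i == a) && (j == d))%:R : F).
  rewrite /munit eqxx andbT; case: (b == c); case: (i == a); case: (j == d);
    by rewrite /= ?mul1r ?mul0r.
by move=> k /negPf kb; rewrite /munit kb andbF mul0r.
Qed.

Lemma brack_munit a b c d : brack (munit F a b) (munit F c d) =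
  (b == c)%:R *: munit F a d - (d == a)%:R *: munit F c b.
Proof. by rewrite /brack !mmul_munit. Qed.

(** Each of the two sums has at most one nonzero term, so a diagonal matrix with infinitely many
    nonzero entries is handled without any convergence issue. *)
Lemma brack_diagE p x i j : diagonal p ->
  brack p x i j = (p i i - p j j) * x i j.
Proof.
move=> dp; rewrite -[LHS]/(mmul p x i j - mmul x p i j : F) /mmul.
rewrite (@fsum_single _ _ _ i) => [|k ki]; last by rewrite dp ?mul0r // eq_sym.
rewrite (@fsum_single _ _ _ j) => [|k kj]; last by rewrite dp ?mulr0.
by rewrite mulrBl [x i j * _]mulrC.
Qed.

Lemma brack_diag_linear p : diagonal p -> linear (brack p : mat F K -> mat F K).
Proof.
move=> dp e x y; apply: mat_ext => i j.
rewrite -[RHS]/(e * brack p x i j + brack p y i j : F) !brack_diagE //.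
by rewrite -[(_ + _) i j]/(e * x i j + y i j : F); ring.
Qed.

Lemma fin_brack_diag p x : diagonal p -> fin x -> fin (brack p x).
Proof.
move=> dp; apply: sub_finite_set => -[i j]; rewrite /msupp /= brack_diagE //.
by apply: contraNneq => ->; rewrite mulr0.
Qed.

(** In each term of the products, [p i i - p j j] splits as the sum of [p i i - p k k] and
    [p k k - p j j]; this avoids associativity of products with the infinite matrix [p]. *)
Lemma brack_leibniz p x y : diagonal p -> fin x -> fin y ->
  brack p (brack x y) = brack (brack p x) y + brack x (brack p y).
Proof.
move=> dp fx fy.
have m u v : fin u -> fin v ->
    forall i j, (p i i - p j j) * mmul u v i j =
      mmul (brack p u) v i j + mmul u (brack p v) i j.
  move=> fu fv i j; have [A hA] := finite_box fu.
  rewrite {1 3}/mmul !(fsbigTE A) => [|k kA|k kA]; last 2 first.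
  - by rewrite hA ?kA ?orbT // mul0r.
  - by rewrite hA ?kA ?orbT // mul0r.
  rewrite /mmul (fsbigTE A) => [|k kA]; last first.
    by rewrite brack_diagE // hA ?kA ?orbT // mulr0 mul0r.
  rewrite mulr_sumr -big_split /=; apply: eq_bigr => k _.
  by rewrite !brack_diagE //; ring.
apply: mat_ext => i j; rewrite brack_diagE //.
rewrite -[brack x y i j]/(mmul x y i j - mmul y x i j : F).
rewrite mulrBr !m // -[RHS]/(mmul (brack p x) y i j - mmul y (brack p x) i j +
  (mmul x (brack p y) i j - mmul (brack p y) x i j) : F).
by ring.
Qed.

Lemma sl_munit a b : a != b -> sl (munit F a b).
Proof.
move=> ab; split; first exact: fin_munit.
apply: fsbig1 => i _; rewrite /munit.
by case: (eqVneq i a) => [->|] //=; rewrite (negPf ab).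
Qed.

Lemma sl_munitB a b : sl (munit F a a - munit F b b).
Proof.
split; first by apply: finD; [|apply: finN]; apply: fin_munit.
rewrite (@box_mtr _ _ [fset a; b]%fset); last first.
  move=> i j h; rewrite -[LHS]/(munit F a a i j - munit F b b i j) /munit.
  move: h; rewrite !in_fset2 !negb_or.
  by case/orP => /andP[/negPf h1 /negPf h2]; rewrite ?h1 ?h2 ?andbF subrr.
pose m c i : F := (i == c)%:R.
rewrite (eq_bigr (fun i => m a i - m b i)); last first.
  by move=> i _; rewrite /m -[LHS]/(munit F a a i i - munit F b b i i) /munit
    !andbb.
rewrite sumrB /m -!natr_sum.
have h c : c \in [fset a; b]%fset -> (\sum_(i <- [fset a; b]%fset) (i == c) = 1)%N.
  move=> cA; rewrite (big_fsetD1 c) //= eqxx big1_fset ?addn0 // => i.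
  by rewrite in_fsetD1 => /andP[/negPf ->].
by rewrite !h ?in_fset2 ?eqxx ?orbT // subrr.
Qed.

(* The trace condition lets a matrix be written with the diagonal part
   expressed through differences e_aa - e_ll for a single l. *)
Lemma sl_ind (Q : mat F K -> Prop) :
  Q 0 -> (forall (e : F) x y, Q x -> Q y -> Q (e *: x + y)) ->
  (forall a b, a != b -> Q (munit F a b)) ->
  (forall A : {fset K}, exists l, forall a, a \in A ->
     Q (munit F a a - munit F l l)) ->
  forall x, sl x -> Q x.
Proof.
move=> Q0 QD Qo Qd x [fx tx]; have [A hA] := finite_box fx.
have [l hl] := Qd A.
have Qs (I : Type) (r : seq I) (P : pred I) (f : I -> mat F K) :
    (forall t, P t -> Q (f t)) -> Q (\sum_(t <- r | P t) f t).
  move=> h; elim/big_rec: _ => // t y Pt Qy.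
  by rewrite -[f t]scale1r; apply: QD => //; apply: h.
have QZ (e : F) y : Q y -> Q (e *: y).
  by move=> h; rewrite -[_ *: _]addr0; apply: QD.
rewrite (box_mtr hA) in tx.
pose xd := \sum_(a <- A) (x a a : F) *: (munit F a a - munit F l l).
pose xo := \sum_(a <- A) \sum_(b <- A | a != b) (x a b : F) *: munit F a b.
suff -> : x = xo + xd.
  rewrite -[xo]scale1r; apply: QD.
    by apply: (Qs) => a _; apply: (Qs) => b ab; apply: (QZ); apply: Qo.
  rewrite /xd big_seq; apply: Qs => a aA; apply: QZ; exact: hl.
have -> : xd = \sum_(a <- A) (x a a : F) *: munit F a a.
  rewrite /xd; under eq_bigr do rewrite scalerBr.
  by rewrite sumrB -scaler_suml tx scale0r subr0.
have -> : xo + \sum_(a <- A) (x a a : F) *: munit F a a =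
    \sum_(a <- A) \sum_(b <- A) (x a b : F) *: munit F a b.
  rewrite /xo -big_split /=; apply: eq_big_seq => a aA.
  rewrite [RHS](bigID (fun b => a == b)) /= addrC; congr (_ + _).
  rewrite big_mkcond (big_fsetD1 a) //= eqxx big_seq big1 ?addr0 // => b.
  by rewrite in_fsetD1 eq_sym => /andP[/negPf ->].
apply: mat_ext => i j.
have sE (I : Type) (r : seq I) (f : I -> mat F K) :
    (\sum_(t <- r) f t) i j = \sum_(t <- r) (f t i j : F).
  by elim/big_rec2: _ => // t y1 y2 _ <-.
rewrite sE; under eq_bigr do rewrite sE.
have [|ijA] := boolP ((i \notin A) || (j \notin A)).
  move=> h; rewrite hA // big_seq big1 // => a aA; rewrite big_seq big1 // => b bA.
  rewrite -[LHS]/(x a b * munit F a b i j) /munit.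
  case: eqP => [ia|]; case: eqP => [jb|]; rewrite ?mulr0 //.
  by move: h; rewrite ia jb aA bA.
move: ijA; rewrite negb_or !negbK => /andP[iA jA].
rewrite (big_fsetD1 i) //= (big_fsetD1 j) //=.
rewrite big_seq big1 => [|b]; last first.
  rewrite in_fsetD1 => /andP[/negPf h _].
  by rewrite -[LHS]/(x i b * munit F i b i j) /munit [j == b]eq_sym h andbF mulr0.
rewrite big_seq big1 => [|a]; last first.
  rewrite in_fsetD1 => /andP[/negPf h _]; apply: big1 => b _.
  by rewrite -[LHS]/(x a b * munit F a b i j) /munit [i == a]eq_sym h mulr0.
by rewrite !addr0 -[RHS]/(x i j * munit F i j i j) /munit !eqxx mulr1.
Qed.

End FiniteMatrices.

(** * Derivations of twisted loop algebras *)

Section LoopOperators.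
Variables (F : fieldType) (K : choiceType).
Implicit Types (p x y : mat F K) (X Y : loop F K) (k m n : int) (a : F).

(** The eigenvalue of [theta] on [part S k]. Being multiplicative in [k], it lets one computation
    cover both parities. *)
Definition parity_sign k : F := if (2 %| k)%Z then 1 else - 1.

Lemma sgD k m : parity_sign (k + m) = parity_sign k * parity_sign m.
Proof.
have : (2 %| k + m)%Z = ((2 %| k)%Z == (2 %| m)%Z) by lia.
rewrite /parity_sign => ->; case: (2 %| k)%Z; case: (2 %| m)%Z;
  by rewrite /= ?mulrNN ?mulr1 ?mul1r.
Qed.

Lemma sg0 : parity_sign 0 = 1. Proof. by []. Qed.

Lemma sgK k : parity_sign k * parity_sign k = 1.
Proof. by rewrite /parity_sign; case: ifP => _; rewrite ?mulrNN mulr1. Qed.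

Lemma loop_ext X Y : (forall k, X k = Y k) -> X = Y.
Proof. by move=> h; apply/funext. Qed.

Lemma tensE x k : tens x k k = x.
Proof. by rewrite /tens eqxx. Qed.

Lemma loop_brack_tens x y k m :
  loop_brack (tens x k) (tens y m) = tens (brack x y) (k + m).
Proof.
apply: loop_ext => n; rewrite /loop_brack (fsbigTE [fset k]%fset).
  rewrite big_seq_fset1 tensE /tens; have -> : (n - k == m) = (n == k + m) by lia.
  by case: ifP => //; rewrite brack0r.
by move=> l; rewrite in_fset1 => /negPf lk; rewrite /tens lk brack0l.
Qed.

Lemma tensZD a x y k : tens (a *: x + y) k = a *: tens x k + tens y k.
Proof.
apply: loop_ext => n; rewrite -[RHS]/(a *: tens x k n + tens y k n) /tens.
by case: ifP => _ //; rewrite scaler0 addr0.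
Qed.

(** All operators of the theorem belong to this family, with [a = 0] in odd degree, so that they are
    treated together. *)
Definition loop_op n p a X := loop_shift n (loop_ad p X + a *: loop_deg X).

Lemma loop_opE n p a X k :
  loop_op n p a X k = brack p (X (k - n)) + (a * (k - n)%:~R) *: X (k - n).
Proof. by rewrite -scalerA. Qed.

Lemma loop_op_tens n p a x k :
  loop_op n p a (tens x k) = tens (brack p x + (a * k%:~R) *: x) (k + n).
Proof.
apply: loop_ext => m; rewrite loop_opE /tens.
have -> : (m - n == k) = (m == k + n) by lia.
case: eqP => [->|_]; first by rewrite addrK.
by rewrite brack0r scaler0 addr0.
Qed.

Lemma loop_op_linear n p a : diagonal p ->
  linear (loop_op n p a : loop F K -> loop F K).
Proof.
move=> dp e X Y; apply: loop_ext => k.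
rewrite -[RHS]/(e *: loop_op n p a X k + loop_op n p a Y k) !loop_opE.
rewrite -[(_ + _) (k - n)]/(e *: X (k - n) + Y (k - n)).
rewrite (brack_diag_linear dp) !scalerDr !scalerA [e * (a * _)]mulrC.
by rewrite addrACA.
Qed.

End LoopOperators.

Section TwistedLoops.
Variables (F : fieldType) (K : choiceType) (S : symm_pair F K).
Hypothesis alg_fin : forall x, alg S x -> fin x.
Implicit Types (p x y : mat F K) (k m n : int) (a e : F).
Implicit Types (X Y : twisted_loop S).

Lemma partE k x : part S k x <-> alg S x /\ theta S x = parity_sign F k *: x.
Proof.
by rewrite /part /parity_sign; case: ifP => _; rewrite ?scale1r ?scaleN1r.
Qed.

Lemma part_alg k x : part S k x -> alg S x.
Proof. by move=> /partE[]. Qed.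

Lemma part_fin k x : part S k x -> fin x.
Proof. by move=> /part_alg; exact: alg_fin. Qed.

Lemma partZ k e x : part S k x -> part S k (e *: x).
Proof. by move=> px; rewrite -[_ *: _]addr0; apply: partZD => //; apply: part0. Qed.

Lemma partD k x y : part S k x -> part S k y -> part S k (x + y).
Proof. by move=> px py; rewrite -[x]scale1r; apply: partZD. Qed.

Lemma part_congr k m x : (2 %| k - m)%Z -> part S k x -> part S m x.
Proof.
move=> km; have : (2 %| k)%Z = (2 %| m)%Z by lia.
by rewrite /part => ->.
Qed.

Lemma loop_val_inj : injective (@loop_val F K S).
Proof. exact: val_inj. Qed.

Lemma loop_part X k : part S k (loop_val X k).
Proof. by case: X => X Xp; have /asboolP[_] := Xp; apply. Qed.

Lemma loop_supp X : exists A : {fset int}, forall k, k \notin A -> loop_val X k = 0.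
Proof.
case: X => X Xp; have /asboolP[fX _] := Xp.
exists (fset_set [set k | X k != 0]) => k.
by rewrite in_fset_set // notin_setE /= => /negP; rewrite negbK => /eqP.
Qed.

Lemma tens_mem k x : part S k x -> tens x k \in @twisted_loop_pred F K S.
Proof.
move=> px; apply/asboolP; split.
  apply: (@sub_finite_set _ _ [set k]); last exact: finite_set1.
  by move=> n /=; rewrite /tens; case: (n =P k) => // _ /eqP[].
by move=> n; rewrite /tens; case: eqP => [->//|_]; exact: part0.
Qed.

(* [ltens x k] is the zero loop when x (x) t^k is not in L. *)
Definition ltens x k : twisted_loop S := insubd 0 (tens x k).

Lemma ltensE k x : part S k x -> loop_val (ltens x k) = tens x k.
Proof. by move=> px; apply: insubdK; exact: tens_mem. Qed.

Lemma ltens_val X k x : X = tens x k :> loop F K -> X = ltens x k.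
Proof.
move=> eX; apply: loop_val_inj; apply: (etrans eX (esym (ltensE _))).
by rewrite -[x](tensE x k) -eX; exact: loop_part.
Qed.

Lemma loop_valZD e X Y : loop_val (e *: X + Y) = e *: loop_val X + loop_val Y.
Proof. by []. Qed.

Lemma ltensZD k e x y : part S k x -> part S k y ->
  ltens (e *: x + y) k = e *: ltens x k + ltens y k.
Proof.
move=> px py; apply: loop_val_inj; rewrite loop_valZD !ltensE ?tensZD //.
exact: partZD.
Qed.

Lemma Lbrack_ltens k m x y : part S k x -> part S m y ->
  Lbrack (ltens x k) (ltens y m) = ltens (brack x y) (k + m).
Proof.
move=> px py; apply: ltens_val => /=.
by rewrite !ltensE // loop_brack_tens.
Qed.

Lemma twisted_loop_ind (W : twisted_loop S -> Prop) :
  W 0 -> (forall X Y, W X -> W Y -> W (X + Y)) ->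
  (forall k x, part S k x -> W (ltens x k)) -> forall X, W X.
Proof.
move=> W0 WD Wt X; have [A hA] := loop_supp X.
suff -> : X = \sum_(k <- A) ltens (loop_val X k) k.
  elim/big_rec: _ => // k Y _ WY; apply: WD => //; apply: Wt; exact: loop_part.
apply: loop_val_inj; rewrite /= [RHS](raddf_sum (val : twisted_loop S -> loop F K)).
rewrite fct_sumE; apply/funext => n.
rewrite (eq_bigr (fun k => tens (loop_val X k) k n)); last first.
  move=> k _; exact: (congr1 (fun Z : loop F K => Z n) (ltensE (loop_part X k))).
have [nA|nA] := boolP (n \in A).
  rewrite (big_fsetD1 n) //= tensE big_seq big1 ?addr0 // => k.
  by rewrite in_fsetD1 /tens eq_sym => /andP[/negPf ->].
rewrite hA // big_seq big1 // => k kA; rewrite /tens.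
by case: eqP => // nk; rewrite nk kA in nA.
Qed.

(** [loop_op] may lead out of L, whereas [Lbrack] takes elements of L; hence the images enter as
    given elements [X'] and [Y']. *)
Lemma loop_op_leibniz n p a X Y X' Y' : diagonal p ->
  X' = loop_op n p a X :> loop F K -> Y' = loop_op n p a Y :> loop F K ->
  loop_op n p a (Lbrack X Y) = Lbrack X' Y + Lbrack X Y' :> loop F K.
Proof.
move=> dp eX eY; apply: loop_ext => N; rewrite loop_opE.
have [A hA] := loop_supp X.
have -> : loop_val (Lbrack X' Y + Lbrack X Y') N =
    loop_brack X' Y N + loop_brack X Y' N.
  by have := loop_valZD 1 (Lbrack X' Y) (Lbrack X Y'); rewrite !scale1r => ->.
(* Reindexing by [k + n] makes both convolutions run over the support [A] of [X]. *)
have -> : loop_brack X' Y N =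
    \sum_(k <- A) brack (loop_val X' (k + n)) (loop_val Y (N - (k + n))).
  rewrite /loop_brack (reindex_fsbigT (fun k => k + n)) /=; last first.
    by exists (fun k => k - n) => k; rewrite ?addrK ?subrK.
  apply: fsbigTE => k kA; rewrite eX loop_opE addrK hA // brack0r scaler0 addr0.
  exact: brack0l.
have -> : loop_brack X Y' N =
    \sum_(k <- A) brack (loop_val X k) (loop_val Y' (N - k)).
  by apply: fsbigTE => k kA; rewrite hA // brack0l.
have -> : loop_val (Lbrack X Y) (N - n) =
    \sum_(k <- A) brack (loop_val X k) (loop_val Y (N - n - k)).
  by apply: fsbigTE => k kA; rewrite hA // brack0l.
rewrite (big_morph (brack p) (id1 := 0) (op1 := +%R)); last 2 first.
- by move=> x y; rewrite -[x]scale1r brack_diag_linear // !scale1r.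
- exact: brack0r.
rewrite scaler_sumr -!big_split /=; apply: eq_bigr => k _.
rewrite eX eY !loop_opE addrK.
have -> : N - (k + n) = N - n - k by lia.
have -> : N - k - n = N - n - k by lia.
have fX := part_fin (loop_part X k).
have fY := part_fin (loop_part Y (N - n - k)).
rewrite brack_leibniz // ![_ + _ *: _]addrC brackZDl ?brackZDr //;
  try exact: fin_brack_diag.
(* The Leibniz rule for t d/dt: the degrees of the two factors add up to the degree of the
   bracket. *)
rewrite [RHS]addrACA -scalerDl -mulrDr -rmorphD /=.
by have -> : k + (N - n - k) = N - n by lia.
Qed.

(** These conditions make [loop_op n p a] preserve L. The bracket with [p] changes the parity by
    that of [n], but the degree operator returns a multiple of [x] itself, which fits in degree
    [k + n] only for even [n]. *)
Definition adapted n p a := [/\ diagonal p,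
  forall x, alg S x -> alg S (brack p x), theta S p = parity_sign F n *: p &
  a = 0 \/ (2 %| n)%Z].

Lemma adapted_part n p a k x : adapted n p a -> part S k x ->
  part S (k + n) (brack p x + (a * k%:~R) *: x).
Proof.
move=> [dp ap tp an] px; apply: partD.
  have [ax tx] := (partE k x).1 px.
  apply/partE; split; first exact: ap.
  rewrite theta_brack tx tp; apply: mat_ext => i j.
  (* The support of [p] may be infinite, so the sign is taken out of the bracket entry by entry. *)
  have dsp : diagonal (parity_sign F n *: p).
    by move=> u v uv; rewrite -[LHS]/(parity_sign F n * p u v : F) dp // mulr0.
  rewrite brack_diagE // -[RHS]/(parity_sign F (k + n) * brack p x i j : F).
  rewrite brack_diagE //.
  rewrite sgD -[(parity_sign F k *: x) i j]/(parity_sign F k * x i j : F).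
  rewrite -[(parity_sign F n *: p) i i]/(parity_sign F n * p i i : F).
  by rewrite -[(parity_sign F n *: p) j j]/(parity_sign F n * p j j : F); ring.
case: an => [->|n2]; first by rewrite mul0r scale0r; exact: part0.
by apply: partZ; apply: part_congr px; lia.
Qed.

Lemma loop_op_mem n p a X : adapted n p a ->
  loop_op n p a X \in @twisted_loop_pred F K S.
Proof.
move=> ad; have [dp _ _ _] := ad; have [A hA] := loop_supp X.
apply/asboolP; split=> [|k].
  apply: (@sub_finite_set _ _ ((fun k => k + n) @` [set` A])).
    move=> k; rewrite /= loop_opE => nz; exists (k - n); last by rewrite subrK.
    apply: contraNT nz => kA; rewrite hA // brack0r scaler0 addr0 //.
  exact: finite_image.
rewrite loop_opE -{1}[k](subrK n); apply: adapted_part => //; exact: loop_part.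
Qed.

Lemma adapted_Der0 n p a : adapted n p a -> DerL S n (on_L S (loop_op n p a)).
Proof.
move=> ad; have [dp _ _ _] := ad.
have [d dE] : exists d : twisted_loop S -> twisted_loop S,
    forall X, loop_val (d X) = loop_op n p a X.
  by exists (fun X => TwistedLoop (loop_op_mem X ad)).
exists d; last by apply/funext.
split; first split.
- move=> e X Y; apply: loop_val_inj.
  by rewrite loop_valZD !dE loop_valZD loop_op_linear.
- by move=> X Y; apply: loop_val_inj; rewrite dE; apply: loop_op_leibniz.
move=> alpha k _ _ [X [x [px wx] eX] <-].
exists (brack p x + (a * k%:~R) *: x); last by rewrite dE eX loop_op_tens.
split; first exact: adapted_part.
move=> h; have dh : diagonal (\val h) by case: h => h /= /set_mem[].
(* Both [h] and [p] scale entries, so their actions commute and weights are preserved. *)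
have := wx h; set c := alpha h => e; apply: mat_ext => i j.
have := congr1 (fun m : mat F K => m i j) e; rewrite !brack_diagE //.
rewrite -[(c *: x) i j]/(c * x i j : F) => eij.
rewrite -[(_ + _) i j]/(brack p x i j + a * k%:~R * x i j : F) brack_diagE //.
rewrite -[RHS]/(c * (brack p x i j + a * k%:~R * x i j) : F) brack_diagE //.
have f (u v w z : F) : u * (v * z + w * z) = (v + w) * (u * z) by ring.
by rewrite !f eij.
Qed.

(** * Values of a derivation on homogeneous elements *)

Section Derivation.
Variable d : twisted_loop S -> twisted_loop S.
Hypothesis Dd : Der d.

(** Membership is part of the relation because [ltens] is zero outside L, where the equation alone
    would carry no information. *)
Definition sends n k x y :=
  [/\ part S k x, part S (k + n) y & d (ltens x k) = ltens y (k + n)].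

Lemma sends_inj n k x y y' : sends n k x y -> sends n k x y' -> y = y'.
Proof.
move=> [_ py ex] [_ py' ex'].
have := congr1 (fun X => loop_val X (k + n)) (etrans (esym ex) ex').
by rewrite !ltensE // !tensE.
Qed.

Lemma der0 : d 0 = 0.
Proof.
have [dl _] := Dd; have := dl 1 0 0; rewrite scaler0 addr0 scale1r => e.
by apply: (addrI (d 0)); rewrite addr0.
Qed.

Lemma sends0 n k : sends n k 0 0.
Proof.
have l0 m : ltens 0 m = 0.
  apply: loop_val_inj; rewrite ltensE; last exact: part0.
  by apply: loop_ext => l; rewrite /tens; case: eqP.
by split; [exact: part0..|rewrite !l0 der0].
Qed.

Lemma sendsZD n k e x y x' y' : sends n k x x' -> sends n k y y' ->
  sends n k (e *: x + y) (e *: x' + y').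
Proof.
move=> [px px' ex] [py py' ey]; split; [exact: partZD..|].
by have [dl _] := Dd; rewrite ltensZD // dl ex ey ltensZD.
Qed.

Lemma sends_brack n k m x y x' y' : sends n k x x' -> sends n m y y' ->
  sends n (k + m) (brack x y) (brack x' y + brack x y').
Proof.
move=> [px px' ex] [py py' ey].
have p1 : part S (k + m + n) (brack x' y).
  by have := part_brack px' py; rewrite addrAC.
have p2 : part S (k + m + n) (brack x y').
  by have := part_brack px py'; rewrite addrA.
split; [exact: part_brack|exact: partD|].
have [_ dD] := Dd; rewrite -Lbrack_ltens // dD ex ey !Lbrack_ltens //.
have := ltensZD 1 p1 p2; rewrite !scale1r => ->.
by rewrite [k + n + m]addrAC addrA.
Qed.

(** Agreement of [d] with [loop_op n p a] at one homogeneous element. It passes to linear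
    combinations and brackets, so it has to be checked on generators only. *)
Definition acts_as n p a k x := sends n k x (brack p x + (a * k%:~R) *: x).

Lemma acts_as0 n p a k : acts_as n p a k 0.
Proof. by rewrite /acts_as brack0r scaler0 addr0; exact: sends0. Qed.

Lemma acts_asZD n p a k e x y : diagonal p ->
  acts_as n p a k x -> acts_as n p a k y -> acts_as n p a k (e *: x + y).
Proof.
move=> dp hx hy; have := sendsZD e hx hy; rewrite /acts_as brack_diag_linear //.
by rewrite !scalerDr !scalerA [e * _]mulrC -!scalerA addrACA.
Qed.

Lemma acts_as_brack n p a k m x y : diagonal p ->
  acts_as n p a k x -> acts_as n p a m y -> acts_as n p a (k + m) (brack x y).
Proof.
move=> dp hx hy; have := sends_brack hx hy; rewrite /acts_as.
have [px _ _] := hx; have [py _ _] := hy.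
have fx := part_fin px; have fy := part_fin py.
have -> : brack (brack p x + (a * k%:~R) *: x) y =
    brack (brack p x) y + (a * k%:~R) *: brack x y.
  by rewrite addrC brackZDl // 1?addrC //; exact: fin_brack_diag.
have -> : brack x (brack p y + (a * m%:~R) *: y) =
    brack x (brack p y) + (a * m%:~R) *: brack x y.
  by rewrite addrC brackZDr // 1?addrC //; exact: fin_brack_diag.
by rewrite (brack_leibniz dp fx fy) intrD mulrDr scalerDl addrACA.
Qed.

Lemma acts_as_op n p a : diagonal p ->
  (forall k x, part S k x -> acts_as n p a k x) ->
  (fun X => loop_val (d X)) = on_L S (loop_op n p a).
Proof.
move=> dp h; apply/funext; have [dl _] := Dd.
apply: twisted_loop_ind => [|X Y eX eY|k x px].
- rewrite der0 -[LHS]/(0 : loop F K); apply: loop_ext => k.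
  by rewrite /on_L loop_opE -[loop_val 0 _]/(0 : mat F K) brack0r scaler0 addr0.
- have := dl 1 X Y; rewrite !scale1r => ->; rewrite /on_L.
  have := loop_valZD 1 X Y; rewrite !scale1r => ->.
  have := loop_valZD 1 (d X) (d Y); rewrite !scale1r => ->.
  have := loop_op_linear n a dp 1 (loop_val X) (loop_val Y).
  by rewrite !scale1r eX eY => ->.
- have [_ py ->] := h k x px.
  by rewrite /on_L !ltensE // loop_op_tens.
Qed.

Lemma sends_root n (alpha : cartan S -> F) k x : Der0 n d -> Delta alpha ->
  wt_space (part S k) alpha x ->
  exists2 y, wt_space (part S (k + n)) alpha y & sends n k x y.
Proof.
move=> [_ h] al [px wx].
have [|y wy e] := h alpha k al (d (ltens x k)).
  exists (ltens x k) => //; exists x => //; exact: ltensE.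
exists y => //; have [py _] := wy; split=> //; exact: ltens_val.
Qed.

End Derivation.
End TwistedLoops.

(** * Weights and cocycles *)

Section Weights.
Variables (F : fieldType) (K : choiceType) (opp : K -> K) (null : pred K).
Hypothesis char0 : [pchar F] =i pred0.
Hypothesis oppK : involutive opp.
Hypothesis null_opp : forall i, null (opp i) = null i.
Hypothesis opp_neq : forall i, ~~ null i -> opp i != i.
Implicit Types (i j l u a b : K) (k m : int).

Lemma natr_neq0 (q : nat) : (q.+1)%:R != 0 :> F.
Proof. by move/pcharf0P: char0 => ->. Qed.

Lemma eq_opp_eq0 (e : F) : e = - e -> e = 0.
Proof.
move/eqP; rewrite -subr_eq0 opprK -mulr2n -mulr_natr mulf_eq0.
by rewrite (negPf (natr_neq0 1)) orbF => /eqP.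
Qed.

Lemma opp_eq i j : (opp i == j) = (i == opp j).
Proof. by apply/eqP/eqP => [<-|->]; rewrite oppK. Qed.

(* The weight of the index a evaluated at e_uu - e_(-u,-u). *)
Definition eps u a : F := (a == u)%:R - (a == opp u)%:R.

Lemma eps_opp u a : eps u (opp a) = - eps u a.
Proof. by rewrite /eps opp_eq (inj_eq (can_inj oppK)) opprB. Qed.

Lemma eps_id u : ~~ null u -> eps u u = 1.
Proof.
by move=> /opp_neq; rewrite /eps eq_sym eqxx => /negPf ->; rewrite subr0.
Qed.

Lemma eps_eq1 u a : eps u a = 1 -> a = u.
Proof.
rewrite /eps; case: (a =P u) => // _; case: eqP => _ /eqP; rewrite sub0r.
  by rewrite eq_sym -subr_eq0 opprK (negPf (natr_neq0 1)).
by rewrite oppr0 eq_sym oner_eq0.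
Qed.

(** The test [u = a] recovers [a], since the value 1 is attained at [u] only. All null indices have
    weight zero and cannot be told apart. *)
Lemma eps_inj a b : (forall u, ~~ null u -> eps u a = eps u b) ->
  a = b \/ null a /\ null b.
Proof.
move=> h; have [na|na] := boolP (null a); have [nb|nb] := boolP (null b).
- by right.
- by left; apply: eps_eq1; rewrite h // eps_id.
- by left; apply/esym/eps_eq1; rewrite -h // eps_id.
- by left; apply: eps_eq1; rewrite h // eps_id.
Qed.

(** At [u = i] the difference of weights is 1. The case [a = opp i] would require [eps i b] to be
    -2, so [a = i] or [b = opp i]; cancelling this index leaves a single weight for [eps_inj]. *)
Lemma eps_pair i j a b : ~~ null i -> j != i -> j != opp i ->
  (forall u, ~~ null u -> eps u a - eps u b = eps u i - eps u j) ->
  (a = i /\ (b = j \/ null b /\ null j)) \/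
  (b = opp i /\ (a = opp j \/ null a /\ null j)).
Proof.
move=> ni /negPf ji /negPf joi h; have := h i ni.
have oi : i != opp i by rewrite eq_sym opp_neq.
rewrite eps_id // {3}/eps ji joi !subr0.
have [ai _|nai] := eqVneq a i.
  left; split=> //; apply: eps_inj => u nu; have := h u nu; rewrite ai.
  by move/addrI/oppr_inj.
have [ai|naoi] := eqVneq a (opp i).
  have -> : eps i a = - 1 by rewrite ai eps_opp eps_id.
  move/eqP; rewrite -subr_eq0 /eps => /eqP e; exfalso.
  (* The successor of this natural number is [2 + eps i b], which is therefore nonzero in
     characteristic 0. *)
  have := natr_neq0 ((b == i) + ~~ (b == opp i)); rewrite -oppr_eq0 -e.
  by case: (b == i); case: (b == opp i) => /eqP[]; rewrite /=; ring.
rewrite {1}/eps (negPf nai) (negPf naoi) subrr sub0r -eps_opp => /eps_eq1 e.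
have {}e : b = opp i by rewrite -e oppK.
right; split=> //; rewrite -(null_opp j); apply: eps_inj => u nu.
have := h u nu; rewrite e !eps_opp opprK [eps u i - _]addrC.
by move/addIr.
Qed.

End Weights.

(** * Cocycles in a pair of indices and a degree *)

Section Cocycles.
Variables (F : fieldType) (K : choiceType) (opp : K -> K).
Hypothesis char0 : [pchar F] =i pred0.
Hypothesis oppK : involutive opp.
Implicit Types (i j l r : K) (k m : int).

Lemma additive_int (f : int -> F) : (forall k m, f (k + m) = f k + f m) ->
  forall k, f k = f 1 * k%:~R.
Proof.
move=> fD; have f0 : f 0 = 0.
  by apply: (addrI (f 0)); rewrite -fD !addr0.
elim/int_rect => [|n IH|n IH]; first by rewrite f0 mulr0.
  by rewrite -addn1 PoszD fD IH intrD mulrDr mulr1.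
have := fD (- n.+1%:Z) 1; have -> : - n.+1%:Z + 1 = - n%:Z by lia.
rewrite IH => e; have -> : - n.+1%:Z = - n%:Z - 1 by lia.
rewrite intrB mulrBr mulr1 e.
rewrite (_ : - n%:Z - 1 = - n.+1%:Z) ?addrK //; lia.
Qed.

(** The pairs that carry a scalar. For [j = opp i] the matrix unit is an eigenvector of sigma up to
    sign, so its symmetrisation vanishes in some degrees. *)
Definition generic i j := (i != j) && (i != opp j).

Local Notation gen := generic.

Lemma genC i j : gen i j = gen j i.
Proof. by rewrite /generic eq_sym -opp_eq // [opp i == j]eq_sym. Qed.

Lemma gen_oppr i j : gen i (opp j) = gen i j.
Proof. by rewrite /generic oppK andbC. Qed.

Lemma gen_oppl i j : gen (opp i) j = gen i j.
Proof. by rewrite genC gen_oppr genC. Qed.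

Hypothesis fresh : forall A : seq K, exists l, forall a, a \in A -> gen l a.

Lemma fresh2 i j : exists l, gen l i /\ gen l j.
Proof.
have [l hl] := fresh [:: i; j]; exists l.
by split; apply: hl; rewrite !inE eqxx ?orbT.
Qed.

Lemma fresh3 i j r : exists l, [/\ gen l i, gen l j & gen l r].
Proof.
have [l hl] := fresh [:: i; j; r]; exists l.
by split; apply: hl; rewrite !inE eqxx ?orbT.
Qed.

Variable c : K -> K -> int -> F.
Hypothesis cD : forall i l j k m, gen i l -> gen l j -> gen i j ->
  c i j (k + m) = c i l k + c l j m.

(** The part depending on the degree, [f], is the same for all generic pairs and hence additive in
    [k]; the values in degree 0 form a cocycle in the indices, which is a coboundary. *)
Lemma cocycle_split :
  exists p a, forall i j k, gen i j -> c i j k = p i - p j + a * k%:~R.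
Proof.
pose f i j k := c i j k - c i j 0.
have fl i j l k : gen i j -> gen j l -> gen i l -> f i l k = f i j k.
  move=> ij jl il; have := cD k 0 ij jl il; rewrite addr0 /f => ->.
  by have := cD 0 0 ij jl il; rewrite addr0 => ->; ring.
have fr i j l k : gen i j -> gen j l -> gen i l -> f i l k = f j l k.
  move=> ij jl il; have := cD 0 k ij jl il; rewrite add0r /f => ->.
  by have := cD 0 0 ij jl il; rewrite addr0 => ->; ring.
(* One index is changed at a time, along (i, j), (i, l), (m, l), (i', l), (i', j') with fresh [l]
   and [m]. *)
have fE i j i' j' k : gen i j -> gen i' j' -> f i j k = f i' j' k.
  move=> ij i'j'; have [l hl] := fresh [:: i; j; i'; j'].
  have [m hm] := fresh [:: i; j; i'; j'; l].
  have s : subseq [:: i; j; i'; j'] [:: i; j; i'; j'; l].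
    by rewrite /= !eqxx.
  have g a : a \in [:: i; j; i'; j'] -> gen a l /\ gen a m.
    move=> aA; rewrite ![gen a _]genC; split; [exact: hl|apply: hm].
    exact: (mem_subseq s).
  have ml : gen m l by apply: hm; rewrite !inE eqxx !orbT.
  have [il im] := g i ltac:(by rewrite !inE eqxx).
  have [jl jm] := g j ltac:(by rewrite !inE eqxx !orbT).
  have [i'l i'm] := g i' ltac:(by rewrite !inE eqxx !orbT).
  have [j'l j'm] := g j' ltac:(by rewrite !inE eqxx !orbT).
  by rewrite -(fl i j l) // (fr i m l) // -(fr i' m l) // (fl i' j' l).
have [r _] := fresh [::]; have [r' hr'] := fresh [:: r].
have rr' : gen r r' by rewrite genC; apply: hr'; rewrite inE.
have fD k m : f r r' (k + m) = f r r' k + f r r' m.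
  have [l [lr lr' _]] := fresh3 r r' r'.
  have rl : gen r l by rewrite genC.
  have e0 := cD 0 0 rl lr' rr'; rewrite addr0 in e0.
  rewrite {1}/f (cD k m rl lr' rr') e0.
  by rewrite (fE r r' r l k) // (fE r r' l r' m) // /f; ring.
have [q hq] := choice (fun i => fresh2 i r).
have c0 i j l : gen i l -> gen l j -> gen i j -> c i j 0 = c i l 0 + c l j 0.
  by move=> il lj ij; rewrite -(cD 0 0 il lj ij) addr0.
(* The natural choice [c i r 0] is not controlled when [i] is [r] or [opp r]. The detour through
   [q i] covers these indices too, and [pE] shows that any other detour gives the same value. *)
pose p i := c i (q i) 0 + c (q i) r 0.
have pE i l : gen l i -> gen l r -> p i = c i l 0 + c l r 0.
  move=> li lr; rewrite /p; have [qi qr] := hq i.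
  have [m hm] := fresh [:: i; l; r; q i].
  have mi : gen i m by rewrite genC; apply: hm; rewrite !inE eqxx.
  have ml : gen l m by rewrite genC; apply: hm; rewrite !inE eqxx !orbT.
  have mr : gen m r by apply: hm; rewrite !inE eqxx !orbT.
  have mq : gen (q i) m by rewrite genC; apply: hm; rewrite !inE eqxx !orbT.
  rewrite (c0 (q i) r m) // (c0 l r m) // !addrA; congr (_ + _).
  by rewrite -c0 -?c0 // genC.
exists p, (f r r' 1) => i j k ij.
have -> : c i j k = c i j 0 + f i j k by rewrite /f; ring.
rewrite (fE i j r r' k) // (additive_int fD); congr (_ + _).
have [l [li lj lr]] := fresh3 i j r.
rewrite (pE i l) // (pE j l) // (c0 i l j) //; last by rewrite genC.
  by ring.
by rewrite genC.
Qed.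

Variable s : F.
Hypothesis s1 : s = 1 \/ s = - 1.
Hypothesis c_opp : forall i j k, gen i j -> c (opp j) (opp i) k = s * c i j k.

(** Inserting the splitting into [c_opp] shows that [p (opp i) + s * p i] does not depend on [i] and
    that [a = s * a]. *)
Lemma cocycle_split_opp : exists p a,
  [/\ forall i j k, gen i j -> c i j k = p i - p j + a * k%:~R,
      forall i, p (opp i) = - (s * p i) & a = 0 \/ s = 1].
Proof.
have [p [a h]] := cocycle_split.
have oij i j : gen i j -> gen (opp j) (opp i).
  by rewrite gen_oppl gen_oppr genC.
have eqE i j k : gen i j ->
    p (opp j) - p (opp i) + a * k%:~R = s * (p i - p j + a * k%:~R).
  by move=> ij; rewrite -(h _ _ _ (oij _ _ ij)) -(h _ _ _ ij) c_opp.
have ss : s * s = 1 by case: s1 => ->; rewrite ?mulrNN mulr1.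
have two : 1 + 1 != 0 :> F by exact: (natr_neq0 char0 1).
have [r _] := fresh [::].
pose kap i := p (opp i) + s * p i.
have kapg i j : gen i j -> kap i = kap j.
  move=> /(eqE _ _ 0); rewrite mulr0 !addr0 /kap => e; apply/esym/eqP.
  rewrite -subr_eq0; apply/eqP; rewrite -[RHS](subrr (s * (p i - p j))) -{1}e; ring.
have kapE i : kap i = kap r.
  by have [l [li lr]] := fresh2 i r; rewrite -(kapg l i) // (kapg l r).
have aE : a = s * a.
  have [l hl] := fresh [:: r]; have lr : gen l r by apply: hl; rewrite inE.
  have := eqE l r 1 lr; have := eqE l r 0 lr.
  by rewrite !mulr1 mulr0 !addr0 [s * (_ + a)]mulrDr => <- /addrI.
have a0 : a = 0 \/ s = 1.
  case: s1 => se; [by right|left; apply/eqP].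
  by rewrite (eq_opp_eq0 char0 (e := a)) // -mulN1r -se.
case: s1 => se.
  (* Only differences of [p] matter, so for [s = 1] half of the constant can be subtracted. *)
  exists (fun i => p i - kap r / (1 + 1)), a; split=> // [i j k ij|i].
    by rewrite h //; ring.
  by rewrite -(kapE i) /kap se; field.
(* For [s = - 1] the constant changes sign under [opp], so it is zero. *)
have k0 : kap r = 0.
  apply: (eq_opp_eq0 char0); rewrite -{1}(kapE (opp r)) /kap oppK se; ring.
exists p, a; split=> // i; have := kapE i; rewrite k0 /kap => /eqP.
by rewrite addr_eq0 => /eqP.
Qed.

End Cocycles.

(** * The involution sigma *)

(** The indices of weight zero: there the diagonal entry of every element of the Cartan subalgebra
    equals its own negative. *)
Definition null_index (I : choiceType) (ty : twisted_type) :
    pred (tw_index I ty) :=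
  match ty with
  | B2 => fun i => (i == j0 I) || (i == j0' I)
  | C2 => pred0
  | BC2 => fun i => i == None
  end.

Lemma swap_j0_eq (I : choiceType) (a u : tw_index I B2) : ~~ @null_index I B2 u ->
  (swap_j0 a == u) = (a == u).
Proof. by case: a => [[a|]|[a|]]; case: u => [[u|]|[u|]]. Qed.

Lemma tau_coroot (F : fieldType) (I : choiceType) (u : tw_index I B2) :
  ~~ @null_index I B2 u ->
  let h := munit F u u - munit F (opp_index u) (opp_index u) in tau h = h.
Proof.
move=> nu h; apply: mat_ext => i j; rewrite tauE.
have hE a b : h a b = ((a == u) && (b == u))%:R -
  ((a == opp_index u) && (b == opp_index u))%:R by [].
have no : ~~ @null_index I B2 (opp_index u) by case: u nu {h hE} => [[u|]|[u|]].
by rewrite !hE !swap_j0_eq.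
Qed.

Section Sigma.
Variables (F : fieldType) (I : choiceType) (ty : twisted_type).
Hypothesis char0 : [pchar F] =i pred0.
Local Notation K := (tw_index I ty).
Local Notation opp := (@opp_index I ty).
Local Notation sgn := (@sgn_index F I ty).
Local Notation null := (@null_index I ty).
Local Notation gen := (@generic K opp).
Local Notation e_ := (@munit F K).
Implicit Types (x y p h : mat F K) (i j l a b u : K) (s t : F).

Lemma null_index_opp i : null (opp i) = null i.
Proof. by case: ty i => [[[i|]|[i|]]|i|[i|]]. Qed.

Lemma opp_index_neq i : ~~ null i -> opp i != i.
Proof. by case: ty i => [[[i|]|[i|]]|[i|i]|[[i|i]|]]. Qed.

Lemma sgn_index_opp a b : sgn (opp a) * sgn (opp b) = sgn a * sgn b.
Proof.
by case: ty a b => [a b|[a|a] [b|b]|a b]; rewrite /= ?mulrNN ?mulrN ?mulNr ?mulr1.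
Qed.

Lemma sigmaZD s x y : sigma (s *: x + y) = s *: sigma x + sigma y.
Proof. exact: sigma_linear. Qed.

Lemma sigma0 : sigma (0 : mat F K) = 0.
Proof.
by apply: mat_ext => i j; rewrite sigmaE -[(0 : mat F K) _ _]/(0 : F) mulr0 oppr0.
Qed.

Lemma sigmaZ s x : sigma (s *: x) = s *: sigma x.
Proof. by rewrite -[s *: x]addr0 sigmaZD sigma0 addr0. Qed.

Lemma sigmaK x : sigma (sigma x) = x.
Proof.
apply: mat_ext => i j; rewrite !sigmaE !opp_indexK mulrN opprK mulrA.
rewrite [sgn (opp j) * _]sgn_index_opp mulrACA [sgn j * sgn i]mulrC.
by rewrite mulrACA !sgn_indexK !mul1r.
Qed.

Lemma sigma_munit a b :
  sigma (e_ a b) = - (sgn a * sgn b) *: e_ (opp b) (opp a).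
Proof.
apply: mat_ext => i j; rewrite sigmaE.
rewrite -[RHS]/(- (sgn a * sgn b) * ((i == opp b) && (j == opp a))%:R : F).
rewrite /munit !(opp_eq (@opp_indexK I ty)) andbC.
case: eqP => [->|]; case: eqP => [->|] => *; rewrite ?mulr0 ?mul0r ?oppr0 //.
by rewrite sgn_index_opp [sgn b * _]mulrC mulNr.
Qed.

Lemma fin_sigma x : fin x -> fin (sigma x).
Proof.
move=> fx; pose f (ij : K * K) := (opp ij.2, opp ij.1).
apply: sub_finite_set (finite_image f fx) => -[i j] nz.
exists (opp j, opp i); last by rewrite /f /= !opp_indexK.
apply: contraNneq nz => /= xz; apply/eqP.
by rewrite /= sigmaE xz mulr0 oppr0.
Qed.

Lemma sl_sigma x : sl x -> sl (sigma x).
Proof.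
move=> [fx tx]; split; first exact: fin_sigma.
rewrite /mtr; under eq_fsbigr do rewrite sigmaE sgn_indexK mul1r.
rewrite fsumN (reindex_fsbigT opp) /=; last by exists opp; exact: opp_indexK.
under eq_fsbigr do rewrite opp_indexK.
by rewrite -/(mtr x) tx oppr0.
Qed.

(** For [s] equal to 1 or -1, twice the projection to the eigenspace of [sigma] with eigenvalue
    [s]. *)
Definition sym s x := x + s *: sigma x.

Lemma fin_sym s x : fin x -> fin (sym s x).
Proof. by move=> fx; apply: finD => //; apply/finZ/fin_sigma. Qed.

Lemma sl_sym s x : sl x -> sl (sym s x).
Proof.
move=> sx; have [_ slD] := @sl_submod F K; rewrite /sym addrC.
apply/asboolP; apply: slD; apply/asboolP => //; exact: sl_sigma.
Qed.

Lemma symZD s t x y : sym s (t *: x + y) = t *: sym s x + sym s y.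
Proof. by rewrite /sym sigmaZD !scalerDr !scalerA [s * t]mulrC addrACA. Qed.

Lemma sym0 s : sym s 0 = 0.
Proof. by rewrite /sym sigma0 scaler0 addr0. Qed.

Lemma symZ s t x : sym s (t *: x) = t *: sym s x.
Proof. by rewrite -[t *: x]addr0 symZD sym0 addr0. Qed.

Lemma symB s x y : sym s (x - y) = sym s x - sym s y.
Proof. by rewrite addrC -scaleN1r symZD scaleN1r addrC. Qed.

Lemma sigma_sym s x : s * s = 1 -> sigma (sym s x) = s *: sym s x.
Proof.
by move=> ss; rewrite /sym addrC sigmaZD sigmaK scalerDr scalerA ss scale1r addrC.
Qed.

Lemma sym_sigma s x : s * s = 1 -> sym s (sigma x) = s *: sym s x.
Proof. by move=> ss; rewrite /sym sigmaK scalerDr scalerA ss scale1r addrC. Qed.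

Lemma sym_munit_opp s a b : s * s = 1 ->
  sym s (e_ (opp b) (opp a)) = - (s * (sgn a * sgn b)) *: sym s (e_ a b).
Proof.
move=> ss; have -> : e_ (opp b) (opp a) = - (sgn a * sgn b) *: sigma (e_ a b).
  rewrite sigma_munit scalerA mulrNN mulrACA !sgn_indexK mulr1.
  by rewrite scale1r.
by rewrite symZ sym_sigma // scalerA mulNr mulrC.
Qed.

(** Applying [sigma] to the vanishing cross term kills the other one; the two remaining terms are
    exchanged by [sigma] up to the sign [s * t]. *)
Lemma brack_sym s t x y : fin x -> fin y -> brack x (sigma y) = 0 ->
  brack (sym s x) (sym t y) = sym (s * t) (brack x y).
Proof.
move=> fx fy xy0; have fsx := fin_sigma fx; have fsy := fin_sigma fy.
have yx0 : brack (sigma x) y = 0.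
  by rewrite -[y]sigmaK -sigma_brack xy0 sigma0.
rewrite /sym brackDl //; last exact: finZ.
rewrite !brackDr //; try exact: finZ.
rewrite !brackZl // !brackZr // xy0 yx0 !scaler0 addr0 add0r scalerA.
by rewrite sigma_brack.
Qed.

Lemma brack_sigma_munit i l j u : l != opp j -> u != opp i ->
  brack (e_ i l) (sigma (e_ u j)) = 0.
Proof.
move=> /negPf lj /negPf ui; rewrite sigma_munit brackZr; last exact: fin_munit.
rewrite brack_munit lj opp_eq ?ui; last exact: opp_indexK.
by rewrite !scale0r subr0 scaler0.
Qed.

(** With a fresh [l], the choice [j = i] produces diagonal elements and [j = opp i] the units whose
    pair is not generic. *)
Lemma brack_sym_munit s t i l j : gen l i -> gen l j ->
  brack (sym s (e_ i l)) (sym t (e_ l j)) =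
  sym (s * t) (e_ i j - (j == i)%:R *: e_ l l).
Proof.
move=> /andP[_ li] /andP[_ lj]; rewrite brack_sym; try exact: fin_munit.
  by rewrite brack_munit eqxx scale1r.
exact: brack_sigma_munit.
Qed.

Lemma brack_diag_munit p i j : diagonal p ->
  brack p (e_ i j) = (p i i - p j j) *: e_ i j.
Proof.
move=> dp; apply: mat_ext => a b; rewrite brack_diagE //.
rewrite -[RHS]/((p i i - p j j) * e_ i j a b : F) /munit.
by case: (eqVneq a i) => [->|]; case: (eqVneq b j) => [->|]; rewrite ?mulr0.
Qed.

Lemma brack_diag_sym s t p x : diagonal p -> t * t = 1 -> sigma p = t *: p ->
  brack p (sym s x) = sym (t * s) (brack p x).
Proof.
move=> dp tt sp; rewrite /sym addrC brack_diag_linear // addrC; congr (_ + _).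
have dtp : diagonal (t *: p).
  by move=> a b ab; rewrite -[LHS]/(t * p a b : F) dp // mulr0.
rewrite sigma_brack sp; apply: mat_ext => i j.
rewrite -[LHS]/(s * brack p (sigma x) i j : F) brack_diagE //.
rewrite -[RHS]/(t * s * brack (t *: p) (sigma x) i j : F) brack_diagE //.
rewrite -[(t *: p) i i]/(t * p i i : F) -[(t *: p) j j]/(t * p j j : F).
by rewrite -[LHS]mul1r -tt; ring.
Qed.

(** * Cartan subalgebra and root spaces *)

Local Notation S := (twisted_pair F I ty).

Lemma twisted_alg_sl x : alg S x -> sl x.
Proof. by case: ty x => // x []. Qed.

Lemma twisted_alg_fin x : alg S x -> fin x.
Proof. by move=> /twisted_alg_sl[]. Qed.

Lemma cartan_sigma (h : cartan S) : diagonal (\val h) /\ sigma (\val h) = \val h.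
Proof. by case: ty h => h; have /set_mem[[[? ?] ?] ?] := valP h. Qed.

Lemma sigma_coroot u :
  sigma (e_ u u - e_ (opp u) (opp u)) = e_ u u - e_ (opp u) (opp u).
Proof.
rewrite addrC -scaleN1r sigmaZD !sigma_munit opp_indexK !sgn_indexK.
by rewrite scalerA mulrNN mulr1 scale1r addrC.
Qed.

(** The elements at which weights are tested. In type B the one for [u = j0] is negated by [tau], so
    it lies in s instead of g. *)
Lemma cartan_coroot u : ~~ null u -> cartan S (e_ u u - e_ (opp u) (opp u)).
Proof.
move=> nu; split; last first.
  move=> i j ij; rewrite -[LHS]/(e_ u u i j - e_ (opp u) (opp u) i j) /munit.
  have E v : (i == v) && (j == v) = false.
    by apply: contraNF ij => /andP[/eqP -> /eqP ->].
  by rewrite !E subrr.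
have sE := sigma_coroot u.
have slE := @sl_munitB F K u (opp u).
case: ty u nu sE slE => // u nu sE slE; split=> //; exact: tau_coroot.
Qed.

(** The weight eps_i - eps_j. Opposite indices give the sums eps_i + eps_j, and a null [j] gives the
    short weight eps_i. *)
Definition root_ij i j (h : cartan S) : F := \val h i i - \val h j j.

(** At a nonzero entry (a, b) each [h] acts by [root_ij a b h], which must therefore be the given
    weight; evaluating at the elements of [cartan_coroot] reduces to [eps_pair]. *)
Lemma root_supp i j y a b : ~~ null i -> gen j i ->
  (forall h : cartan S, brack (\val h) y = root_ij i j h *: y) ->
  y a b != 0 ->
  (a = i /\ (b = j \/ null b /\ null j)) \/
  (b = opp i /\ (a = opp j \/ null a /\ null j)).
Proof.
move=> ni /andP[ji joi] wy yab.
apply: (eps_pair char0 (@opp_indexK I ty) null_index_opp opp_index_neq) => // u nu.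
have [h hE] : exists h : cartan S, \val h = e_ u u - e_ (opp u) (opp u).
  by exists (exist (fun x => x \in cartan S) _ (mem_set (cartan_coroot nu))).
have [dh _] := cartan_sigma h.
have := congr1 (fun m : mat F K => m a b) (wy h); rewrite brack_diagE //.
rewrite -[(_ *: y) a b]/(root_ij i j h * y a b : F) => /(mulIf yab).
have E v : \val h v v = eps F opp u v.
  by rewrite hE -[LHS]/(e_ u u v v - e_ (opp u) (opp u) v v) /munit !andbb.
by rewrite /root_ij !E.
Qed.

Lemma wt_sym s i j (h : cartan S) :
  brack (\val h) (sym s (e_ i j)) = root_ij i j h *: sym s (e_ i j).
Proof.
have [dh sh] := cartan_sigma h.
rewrite (@brack_diag_sym _ 1) ?mulr1 ?scale1r // mul1r.
by rewrite brack_diag_munit // symZ.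
Qed.

Lemma root_ij_Delta i j k x : ~~ null i -> gen j i -> x != 0 ->
  wt_space (part S k) (root_ij i j) x -> Delta (root_ij i j).
Proof.
move=> ni /andP[/negPf ji /negPf joi] x0 [px wx]; split; last first.
  exists x => //; split=> //; move: px; rewrite /part; case: ifP => _ px.
    by exists x => //; exists 0; [have := part0 S 1|rewrite addr0].
  by exists 0; [have := part0 S 0|exists x => //; rewrite add0r].
exists (exist (fun x => x \in cartan S) _ (mem_set (cartan_coroot ni))).
rewrite /root_ij /=.
have -> : (e_ i i - e_ (opp i) (opp i)) i i = 1.
  have := eps_id F opp_index_neq ni; rewrite /eps => <-.
  by rewrite -[LHS]/(e_ i i i i - e_ (opp i) (opp i) i i) /munit !andbb.
have -> : (e_ i i - e_ (opp i) (opp i)) j j = 0.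
  rewrite -[LHS]/(e_ i i j j - e_ (opp i) (opp i) j j) /munit.
  by rewrite ji joi subrr.
by rewrite subr0 oner_eq0.
Qed.

Definition diagm (p : K -> F) : mat F K := fun i j => if i == j then p i else 0.

Lemma diagm_diagonal (p : K -> F) : diagonal (diagm p).
Proof. by move=> i j /negPf ij; rewrite /diagm ij. Qed.

Lemma diagmE (p : K -> F) i : diagm p i i = p i.
Proof. by rewrite /diagm eqxx. Qed.

Lemma sigma_diagm (p : K -> F) s : (forall i, p (opp i) = - (s * p i)) ->
  sigma (diagm p) = s *: diagm p.
Proof.
move=> ps; apply: mat_ext => i j; rewrite sigmaE.
rewrite -[RHS]/(s * diagm p i j : F) /diagm.
rewrite (inj_eq (can_inj (@opp_indexK I ty))) eq_sym.
by case: eqP => [->|]; rewrite ?mulr0 ?oppr0 // sgn_indexK mul1r ps opprK.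
Qed.

Hypothesis Iinf : infinite_set [set: I].

(** [f] embeds the infinite set I into the indices that are not null, and only finitely many of its
    values lie in [A] or its image under [opp]. *)
Lemma fresh_index (A : seq K) : exists l, ~~ null l /\ forall a, a \in A -> gen l a.
Proof.
pose f (i : I) : K := match ty with
  | B2 => inl (Some i) | C2 => inl i | BC2 => Some (inl i) end.
have fin_A : finite_set (f @^-1` [set` A ++ map opp A]).
  apply: finite_preimage (finite_seq _) => i j _ _.
  by rewrite /f; case: ty => /= -[].
have [v vA] : exists v, ~ (f @^-1` [set` A ++ map opp A]) v.
  apply: contrapT => h; apply: Iinf; apply: sub_finite_set fin_A => v _.
  by apply: contrapT => nv; apply: h; exists v.
exists (f v); split; first by rewrite /f; case: ty.
move: vA; rewrite /= mem_cat => /negP; rewrite negb_or => /andP[h1 h2] a aA.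
rewrite /generic; apply/andP; split.
  by apply: contraNneq h1 => ->.
by apply: contraNneq h2 => ->; apply: map_f.
Qed.

End Sigma.

(** * Types C and BC *)

Section SlTypes.
Variables (F : fieldType) (I : choiceType) (ty : twisted_type).
Hypothesis char0 : [pchar F] =i pred0.
Hypothesis Iinf : infinite_set [set: I].
Hypothesis ty_sl : ty <> B2.
Local Notation K := (tw_index I ty).
Local Notation opp := (@opp_index I ty).
Local Notation null := (@null_index I ty).
Local Notation gen := (@generic K opp).
Local Notation e_ := (@munit F K).
Local Notation S := (twisted_pair F I ty).
Local Notation sg := (@parity_sign F).
Local Notation oppK := (@opp_indexK I ty).
Local Notation alg_fin := (@twisted_alg_fin F I ty).
Local Notation genC := (genC oppK).
Local Notation gen_oppr := (gen_oppr oppK).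
Local Notation gen_oppl := (gen_oppl oppK).
Implicit Types (x y p : mat F K) (i j l a b : K) (s t : F) (k m n : int).

Lemma sl_partE k x : part S k x <-> sl x /\ sigma x = sg k *: x.
Proof. by rewrite partE; case: ty ty_sl x. Qed.

Lemma null_uniq i j : null i -> null j -> i = j.
Proof. by case: ty ty_sl i j => // _ i j /eqP -> /eqP ->. Qed.

Lemma part_sym k x : sl x -> part S k (sym (sg k) x).
Proof.
by move=> sx; apply/sl_partE; split; [exact: sl_sym|apply: sigma_sym; exact: sgK].
Qed.

Lemma sym_munit_id s i j : gen i j -> sym s (e_ i j) i j = 1.
Proof.
move=> /andP[_ /negPf ij]; rewrite /sym sigma_munit.
rewrite -[LHS]/(e_ i j i j + s * (- (sgn_index F i * sgn_index F j) *
  e_ (opp j) (opp i) i j) : F).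
by rewrite /munit !eqxx ij !mulr0 addr0.
Qed.

Lemma root_ij_opp i j : root_ij (F := F) (opp j) (opp i) = root_ij (F := F) i j.
Proof.
apply/funext => h; have [dh sh] := cartan_sigma h.
have E a : \val h (opp a) (opp a) = - \val h a a.
  by rewrite -{1}sh sigmaE oppK sgn_indexK mul1r.
by rewrite /root_ij !E opprK addrC.
Qed.

(** There is at most one null index, so the ambiguity left by [root_supp] disappears. When [i]
    itself is null, the same root is written with the pair (opp j, opp i). *)
Lemma sl_root_supp i j y a b : gen i j ->
  (forall h : cartan S, brack (\val h) y = root_ij i j h *: y) ->
  y a b != 0 -> (a = i /\ b = j) \/ (a = opp j /\ b = opp i).
Proof.
move=> ij wy yab; have [ni|ni] := boolP (null i).
  have nj : ~~ null j.
    by apply: contraTN ij => nj; rewrite (null_uniq ni nj) /generic eqxx.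
  have noj : ~~ null (opp j) by rewrite null_index_opp.
  have ij' : gen (opp i) (opp j) by rewrite gen_oppl gen_oppr.
  have wy' (h : cartan S) :
      brack (\val h) y = root_ij (opp j) (opp i) h *: y by rewrite root_ij_opp.
  case: (root_supp char0 noj ij' wy' yab) => -[-> h]; rewrite ?oppK in h *.
    by right; split=> //; case: h => // -[nb noi]; exact: null_uniq.
  by left; split=> //; case: h => // -[na _]; exact: null_uniq.
have ji : gen j i by rewrite genC.
case: (root_supp char0 ni ji wy yab) => -[-> h].
  by left; split=> //; case: h => // -[nb nj]; exact: null_uniq.
right; split=> //; case: h => // -[na nj]; apply: null_uniq => //.
by rewrite null_index_opp.
Qed.

Lemma wt_spaceZD k (alpha : cartan S -> F) s x y :
  wt_space (part S k) alpha x -> wt_space (part S k) alpha y ->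
  wt_space (part S k) alpha (s *: x + y).
Proof.
move=> [px wx] [py wy]; split; first exact: partZD.
move=> h; have [dh _] := cartan_sigma h.
by rewrite brack_diag_linear // wx wy scalerDr !scalerA mulrC.
Qed.

Lemma wt_space_sym k i j : i != j ->
  wt_space (part S k) (root_ij i j) (sym (sg k) (e_ i j)).
Proof. by move=> ij; split; [exact/part_sym/sl_munit|exact: wt_sym]. Qed.

(** After subtracting the multiple with the same entry at (i, j), the only other possible entry is
    at (opp j, opp i), and [sigma] ties it to the vanishing one. *)
Lemma sl_root_line k i j y : gen i j -> wt_space (part S k) (root_ij i j) y ->
  y = y i j *: sym (sg k) (e_ i j).
Proof.
move=> ij wy; have /andP[neij _] := ij.
pose z := - y i j *: sym (sg k) (e_ i j) + y.
have [pz wz] : wt_space (part S k) (root_ij i j) z.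
  by apply: wt_spaceZD => //; exact: wt_space_sym.
have zij : z i j = 0.
  rewrite -[LHS]/(- y i j * sym (sg k) (e_ i j) i j + y i j : F).
  by rewrite sym_munit_id // mulr1 addNr.
suff z0 : z = 0.
  by move/eqP: z0; rewrite /z scaleNr addrC subr_eq0 => /eqP.
apply: mat_ext => a b; apply/eqP; apply: contraT => zab.
case: (sl_root_supp ij wz zab) => -[ea eb]; move: zab; rewrite ea eb ?zij ?eqxx //.
have /sl_partE[_ sz] := pz.
have := congr1 (fun m : mat F K => m (opp j) (opp i)) sz; rewrite sigmaE !oppK zij.
rewrite mulr0 oppr0 -[(_ *: z) _ _]/(sg k * z (opp j) (opp i) : F) => e.
by rewrite -[z _ _]mul1r -(sgK F k) -mulrA -e mulr0 eqxx.
Qed.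

Lemma sl_root_Delta i j : gen i j -> Delta (root_ij (F := F) i j).
Proof.
move=> ij; have /andP[neij _] := ij.
have h a b : gen a b -> ~~ null a -> Delta (root_ij (F := F) a b).
  move=> ab na; have /andP[neab _] := ab.
  apply: (root_ij_Delta (k := 0) (x := sym (sg 0) (e_ a b))) => //.
  - by rewrite genC.
  - apply/eqP => /(congr1 (fun m : mat F K => m a b)).
    by rewrite sym_munit_id // => /eqP; rewrite oner_eq0.
  - exact: wt_space_sym.
have [ni|] := boolP (null i); last exact: h.
rewrite -root_ij_opp; apply: h.
  by rewrite gen_oppl gen_oppr genC.
rewrite null_index_opp.
by apply: contraTN ij => nj; rewrite (null_uniq ni nj) /generic eqxx.
Qed.

Lemma brack_sym_gen k m i l j : gen l i -> gen l j -> i != j ->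
  brack (sym (sg k) (e_ i l)) (sym (sg m) (e_ l j)) = sym (sg (k + m)) (e_ i j).
Proof.
move=> li lj ij; rewrite brack_sym_munit // -sgD [j == i]eq_sym (negPf ij).
by rewrite scale0r subr0.
Qed.

Lemma fin_sym_munit s i j : fin (sym s (e_ i j)).
Proof. exact/fin_sym/fin_munit. Qed.

Section Derivation.
Variables (n : int) (d : twisted_loop S -> twisted_loop S).
Hypothesis Dd : Der0 n d.
Local Notation sends := (@sends F _ S d n).

Lemma sl_coefs : exists c : K -> K -> int -> F, forall i j k, gen i j ->
  sends k (sym (sg k) (e_ i j)) (c i j k *: sym (sg (k + n)) (e_ i j)).
Proof.
have h (v : K * K * int) : exists c, let: (i, j, k) := v in gen i j ->
    sends k (sym (sg k) (e_ i j)) (c *: sym (sg (k + n)) (e_ i j)).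
  case: v => [[i j] k]; have [ij|_] := boolP (gen i j); last by exists 0.
  have /andP[neij _] := ij.
  have [y wy sy] := sends_root Dd (sl_root_Delta ij) (wt_space_sym k neij).
  by exists (y i j) => _; rewrite -sl_root_line.
have [c hc] := choice h; exists (fun i j k => c (i, j, k)) => i j k.
exact: (hc (i, j, k)).
Qed.

Variable c : K -> K -> int -> F.
Hypothesis cE : forall i j k, gen i j ->
  sends k (sym (sg k) (e_ i j)) (c i j k *: sym (sg (k + n)) (e_ i j)).

Lemma sl_coefs_inj i j k s : gen i j ->
  sends k (sym (sg k) (e_ i j)) (s *: sym (sg (k + n)) (e_ i j)) -> c i j k = s.
Proof.
move=> ij h; have := sends_inj (cE k ij) h.
move=> /(congr1 (fun m : mat F K => m i j)).
rewrite -[LHS]/(c i j k * sym (sg (k + n)) (e_ i j) i j : F).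
rewrite -[RHS]/(s * sym (sg (k + n)) (e_ i j) i j : F).
by rewrite sym_munit_id // !mulr1.
Qed.

Lemma sl_coefsD i l j k m : gen i l -> gen l j -> gen i j ->
  c i j (k + m) = c i l k + c l j m.
Proof.
move=> il lj ij; have /andP[neij _] := ij.
have li : gen l i by rewrite genC.
have [dl dB] := Dd; apply: sl_coefs_inj => //.
have := sends_brack dl (cE k il) (cE m lj).
rewrite brackZl ?brackZr ?brack_sym_gen //; try exact: fin_sym_munit.
by rewrite [k + n + m]addrAC [k + (m + n)]addrA -scalerDl.
Qed.

(** Both pairs give the same root vector up to a sign containing [sg k]. The source has degree [k]
    and the image degree [k + n], so [sg n] remains. *)
Lemma sl_coefs_opp i j k : gen i j -> c (opp j) (opp i) k = sg n * c i j k.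
Proof.
move=> ij; have [dl dB] := Dd.
have oij : gen (opp j) (opp i).
  by rewrite gen_oppl gen_oppr genC.
apply: sl_coefs_inj => //.
rewrite !(sym_munit_opp _ _ (sgK F _)).
pose t := sgn_index F i * sgn_index F j.
have := sendsZD dl (- (sg k * t)) (cE k ij) (sends0 dl n k).
rewrite !addr0 !scalerA; congr sends; congr (_ *: _); rewrite sgD /t.
by rewrite -[LHS]mul1r -(sgK F n); ring.
Qed.

End Derivation.

Lemma sg_eq1 n : sg n = 1 -> (2 %| n)%Z.
Proof.
rewrite /parity_sign; case: ifP => // _ /esym /(eq_opp_eq0 char0)/eqP.
by rewrite oner_eq0.
Qed.

Lemma adapted_sl n p (r : F) : diagonal p -> sigma p = sg n *: p ->
  r = 0 \/ (2 %| n)%Z -> adapted S n p r.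
Proof.
move=> dp sp rn; split=> //; last by case: ty ty_sl p dp sp.
have h x : sl x -> sl (brack p x).
  move=> [fx _]; split; first exact: fin_brack_diag.
  by apply: fsbig1 => i _; rewrite brack_diagE // subrr mul0r.
by case: ty ty_sl p dp sp h.
Qed.

Lemma DerL_sl n D : DerL S n D -> exists p (r : F),
  [/\ diagonal p, sigma p = sg n *: p, r = 0 \/ (2 %| n)%Z &
      D = on_L S (loop_op n p r)].
Proof.
move=> [d Dd <-]; have [c cE] := sl_coefs Dd; have [dl _] := Dd.
have fresh (A : seq K) : exists l, forall a, a \in A -> gen l a.
  by have [l [_ hl]] := @fresh_index I ty Iinf A; exists l.
have s1 : sg n = 1 \/ sg n = - 1 by rewrite /parity_sign; case: ifP; [left|right].
have [p [r [hc pp rn]]] := cocycle_split_opp char0 oppK fresh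
  (sl_coefsD Dd cE) s1 (sl_coefs_opp Dd cE).
have dp := @diagm_diagonal F I ty p.
exists (diagm p), r; split=> //.
- exact: sigma_diagm.
- by case: rn => [|/sg_eq1]; [left|right].
have gens k i j : gen i j -> acts_as d n (diagm p) r k (sym (sg k) (e_ i j)).
  move=> ij; rewrite /acts_as; have := cE i j k ij; rewrite hc //; congr sends.
  rewrite (brack_diag_sym _ _ dp (sgK F n) (sigma_diagm pp)).
  rewrite brack_diag_munit // !diagmE symZ -sgD [n + k]addrC scalerDl.
  (* The degree term keeps the sign of degree [k], which agrees with that of [k + n] when
     [sg n = 1]; otherwise its coefficient is 0. *)
  by congr (_ + _); case: rn => [->|n1]; rewrite ?mul0r ?scale0r // sgD n1 mulr1.
have sym_acts k x : sl x -> acts_as d n (diagm p) r k (sym (sg k) x).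
  move: x; apply: sl_ind.
  - by rewrite sym0; exact: (acts_as0 dl).
  - by move=> s x y hx hy; rewrite symZD; apply: (acts_asZD dl).
  - move=> a b ab; have [abg|] := boolP (gen a b); first exact: gens.
    rewrite /generic ab negbK => /eqP aob.
    (* The remaining pair is (a, opp a); its unit is a bracket of two generic ones through [l]. *)
    have [l hl] := fresh [:: a; b].
    have la : gen l a by apply: hl; rewrite inE eqxx.
    have lb : gen l b by apply: hl; rewrite !inE eqxx orbT.
    rewrite -[k]addr0 -(brack_sym_gen _ _ la lb ab).
    apply: (acts_as_brack alg_fin dl) => //; apply: gens => //.
    by rewrite genC.
  - move=> A; have [l hl] := fresh A; exists l => a aA; have la := hl a aA.
    have := brack_sym_munit (sg k) (sg 0) la la.
    rewrite eqxx scale1r sg0 mulr1 => <-; rewrite -[k in acts_as _ _ _ _ k]addr0.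
    apply: (acts_as_brack alg_fin dl) => //; last by rewrite -(sg0 F); apply: gens.
    by apply: gens; rewrite genC.
apply: (acts_as_op dl) => // k x /sl_partE[sx ex].
have two : 1 + 1 != 0 :> F by exact: (natr_neq0 char0 1).
(* An element of [part S k] is half its own symmetrisation. *)
have -> : x = (1 + 1)^-1 *: sym (sg k) x + 0.
  have xx : x + x = (1 + 1) *: x by rewrite scalerDl scale1r.
  by rewrite addr0 /sym ex scalerA sgK scale1r xx scalerA mulVf // scale1r.
apply: (acts_asZD dl) => //; first exact: sym_acts.
exact: (acts_as0 dl).
Qed.

End SlTypes.

(** * Type B *)

Lemma brackZD2 (F : fieldType) (K : choiceType) (s t : F) (x y z w : mat F K) :
  fin x -> fin y -> fin z -> fin w ->
  brack (x + s *: y) (z + t *: w) =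
  brack x z + t *: brack x w + s *: (brack y z + t *: brack y w).
Proof.
move=> fx fy fz fw; have ft := finZ t fw; have fs := finZ s fy.
by rewrite brackDl // brackZl // !brackDr // !brackZr.
Qed.

Section TypeB.
Variables (F : fieldType) (I : choiceType).
Hypothesis char0 : [pchar F] =i pred0.
Hypothesis Iinf : infinite_set [set: I].
Local Notation K := (tw_index I B2).
Local Notation opp := (@opp_index I B2).
Local Notation null := (@null_index I B2).
Local Notation gen := (@generic K opp).
Local Notation e_ := (@munit F K).
Local Notation S := (twisted_pair F I B2).
Local Notation sg := (@parity_sign F).
Local Notation oppK := (@opp_indexK I B2).
Local Notation genC := (genC oppK).
Local Notation gen_oppr := (gen_oppr oppK).
Local Notation gen_oppl := (gen_oppl oppK).
Local Notation alg_fin := (@twisted_alg_fin F I B2).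
Local Notation o := (@j0 I).
Local Notation o' := (@j0' I).
Local Notation sym1 := (@sym F I B2 1).
Implicit Types (x y z : mat F K) (i j l a b u : K) (s t : F) (k m n : int).

Lemma null_cases i : null i -> i = o \/ i = o'.
Proof. by case/orP => /eqP ->; [left|right]. Qed.

Lemma gen_null i l : ~~ null i -> null l -> gen i l.
Proof. by move=> ni /null_cases[] ->; case: i ni => [[i|]|[i|]]. Qed.

Lemma oB2_partE k x :
  part S k x <-> (sl x /\ sigma x = x) /\ tau x = sg k *: x.
Proof. by rewrite partE. Qed.

Lemma tauZD s x y : tau (s *: x + y) = s *: tau x + tau y.
Proof. exact: tau_linear. Qed.

Lemma tau0 : tau (0 : mat F K) = 0.
Proof. by apply: mat_ext => i j; rewrite tauE. Qed.

Lemma tauZ s x : tau (s *: x) = s *: tau x.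
Proof. by rewrite -[s *: x]addr0 tauZD tau0 addr0. Qed.

Lemma tauK x : tau (tau x) = x.
Proof. by apply: mat_ext => i j; rewrite !tauE !swap_j0K. Qed.

Lemma tau_munit a b : tau (e_ a b) = e_ (swap_j0 a) (swap_j0 b).
Proof.
by apply: mat_ext => i j; rewrite tauE /munit !(opp_eq (@swap_j0K I)).
Qed.

Lemma tau_sigma x : tau (sigma x) = sigma (tau x).
Proof.
apply: mat_ext => i j; rewrite tauE !sigmaE tauE /=.
by case: i => [[i|]|[i|]]; case: j => [[j|]|[j|]].
Qed.

Lemma sl_tau x : sl x -> sl (tau x).
Proof.
move=> [fx tx]; split.
  pose f (ij : K * K) := (swap_j0 ij.1, swap_j0 ij.2).
  apply: sub_finite_set (finite_image f fx) => -[i j]; rewrite /= tauE => nz.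
  by exists (swap_j0 i, swap_j0 j); rewrite /f /= ?swap_j0K.
rewrite /mtr; under eq_fsbigr do rewrite tauE.
rewrite -[RHS]tx /mtr [RHS](reindex_fsbigT (@swap_j0 I)) //=.
by exists (@swap_j0 I); exact: swap_j0K.
Qed.

(** As [sigma] and [tau] commute, for [s] equal to 1 or -1 this is four times the projection to the
    common eigenspace with [sigma = 1] and [tau = s]. *)
Definition tsym s x := sym1 x + s *: tau (sym1 x).

Lemma tsymZD s t x y : tsym s (t *: x + y) = t *: tsym s x + tsym s y.
Proof. by rewrite /tsym symZD tauZD !scalerDr !scalerA [s * t]mulrC addrACA. Qed.

Lemma tsym0 s : tsym s 0 = 0.
Proof. by rewrite /tsym sym0 tau0 scaler0 addr0. Qed.

Lemma part_tsym k x : sl x -> part S k (tsym (sg k) x).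
Proof.
move=> sx; have ss := sl_sym 1 sx; apply/oB2_partE; split; first split.
- have [_ slD] := @sl_submod F K; rewrite /tsym addrC.
  by apply/asboolP; apply: slD; apply/asboolP => //; exact: sl_tau.
- by rewrite /tsym addrC sigmaZD -tau_sigma sigma_sym ?mulr1 // scale1r.
- rewrite /tsym; move: (sym1 x) => y.
  by rewrite addrC tauZD tauK scalerDr scalerA sgK scale1r addrC.
Qed.

Local Notation vm a b := (sym1 (e_ a b)).

Lemma fin_vm a b : fin (vm a b).
Proof. exact/fin_sym/fin_munit. Qed.

Lemma vm_opp a b : vm (opp b) (opp a) = - vm a b.
Proof. by rewrite sym_munit_opp ?mulr1 // scaleN1r. Qed.

Lemma vm_anti a : vm a (opp a) = 0.
Proof.
have := vm_opp a (opp a); rewrite oppK => e.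
have two : 1 + 1 != 0 :> F by exact: (natr_neq0 char0 1).
apply: (scalerI two); rewrite scaler0 scalerDl scale1r {1}e.
by rewrite addNr.
Qed.

Lemma tau_vm a b : tau (vm a b) = vm (swap_j0 a) (swap_j0 b).
Proof. by rewrite /sym addrC tauZD tau_sigma tau_munit addrC. Qed.

Lemma swap_nonnull i : ~~ null i -> swap_j0 i = i.
Proof. by case: i => [[i|]|[i|]]. Qed.

Lemma vm_id i l : gen i l -> vm i l i l = 1.
Proof. exact: sym_munit_id. Qed.

Lemma brack_vm i l u j : l != opp j -> u != opp i ->
  brack (vm i l) (vm u j) =
  sym1 ((l == u)%:R *: e_ i j - (j == i)%:R *: e_ u l).
Proof.
move=> lj ui; rewrite brack_sym ?mulr1 ?brack_munit //; try exact: fin_munit.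
exact: brack_sigma_munit.
Qed.

(* For s = (-1)^k, it spans the root space of weight eps_i in degree k. *)
Definition short_vec s i := vm i o + s *: vm i o'.

Local Notation Y := short_vec.

Lemma fin_Y s i : fin (Y s i).
Proof. by apply: finD; [|apply: finZ]; apply: fin_vm. Qed.

Lemma tsym_Y s i : ~~ null i -> tsym s (e_ i o) = Y s i.
Proof. by move=> ni; rewrite /tsym tau_vm swap_nonnull. Qed.

Lemma brack_vmY s i l : ~~ null i -> ~~ null l -> gen i l ->
  brack (vm i l) (Y s l) = Y s i.
Proof.
move=> ni nl il; have /andP[neil neoil] := il.
have h j : null j -> brack (vm i l) (vm l j) = vm i j.
  move=> nj; rewrite brack_vm.
  - rewrite eqxx scale1r (_ : (j == i) = false) ?scale0r ?subr0 //.
    by apply: contraNF ni => /eqP <-.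
  - by have /andP[] := gen_null nl nj.
  - by rewrite -(opp_eq oppK) eq_sym.
rewrite /short_vec brackDr ?h //; last 2 first.
- exact: fin_vm.
- by apply: finZ; exact: fin_vm.
by rewrite brackZr ?h //; exact: fin_vm.
Qed.

(** For [l != i] the result vanishes exactly when the signs are opposite, which separates even from
    odd degrees. For [l = i] equal signs give a multiple of the coroot of [i], opposite signs the
    line s_0 spanned by [vm o o]. *)
Lemma brack_YY s t i l : ~~ null i -> ~~ null l ->
  brack (Y s i) (Y t (opp l)) =
  - (s + t) *: vm i l + ((l == i)%:R * (t - s)) *: vm o o.
Proof.
move=> ni nl.
(* With [l] as column index, the matrix units of the two factors are multiplied at the null
   indices. *)
have -> : Y t (opp l) = - (vm o' l + t *: vm o l).
  have e1 : vm (opp l) o = - vm o' l := vm_opp o' l.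
  have e2 : vm (opp l) o' = - vm o l := vm_opp o l.
  rewrite /short_vec e1 e2; move: (vm o' l) (vm o l) => x y.
  by rewrite scalerN opprD.
rewrite brackNr /short_vec.
have nn (a b : K) : ~~ null a -> null b -> (a == b) = false.
  by move=> na nb; apply: contraNF na => /eqP ->.
have nn' (a b : K) : ~~ null a -> null b -> (b == a) = false.
  by move=> na nb; rewrite eq_sym nn.
have no (a : K) : ~~ null a -> ~~ null (opp a) by rewrite null_index_opp.
have h a b : null a -> null b -> brack (vm i a) (vm b l) =
    (a == b)%:R *: vm i l - (l == i)%:R *: vm b a.
  move=> na nb; have := nn' _ _ (no l nl) na; have := nn' _ _ (no i ni) nb.
  by move=> h1 h2; rewrite brack_vm ?h1 ?h2 // symB !symZ.
rewrite brackZD2 ?h //; try exact: fin_vm.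
have -> : vm o' o' = - vm o o := vm_opp o o.
have -> : vm o o' = 0 := vm_anti o.
have -> : vm o' o = 0 := vm_anti o'.
move: (vm i l) (vm o o) => x y.
rewrite (_ : o == o' = false) // (_ : o' == o = false) // !eqxx.
move: (l == i)%:R => e; rewrite !scale0r !scaler0 !subr0 !scale1r scalerN opprK.
rewrite add0r scaler0 addr0; apply: mat_ext => a b.
rewrite -[LHS]/(- (t * (x a b - e * y a b) + s * (x a b + e * y a b)) : F).
rewrite -[RHS]/(- (s + t) * x a b + e * (t - s) * y a b : F).
by ring.
Qed.

Lemma Y_id s i : ~~ null i -> Y s i i o = 1.
Proof.
move=> ni; have e2 : vm i o' i o = 0.
  rewrite /sym sigma_munit.
  rewrite -[LHS]/(e_ i o' i o + 1 * (- (1 * 1) * e_ o (opp i) i o) : F).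
  rewrite /munit (_ : o == o' = false) // (_ : i == o = false).
    by rewrite !andbF !mulr0 addr0.
  by apply: contraNF ni => /eqP ->.
have io : gen i o by apply: gen_null.
by rewrite -[LHS]/(vm i o i o + s * vm i o' i o : F) vm_id // e2 mulr0 addr0.
Qed.

Lemma wt_Y k i : ~~ null i -> wt_space (part S k) (root_ij i o) (Y (sg k) i).
Proof.
move=> ni; split.
  by rewrite -tsym_Y //; apply/part_tsym/sl_munit; apply: contraNneq ni => ->.
move=> h; have [dh sh] := cartan_sigma h.
have h0 : \val h o o = \val h o' o'.
  have /set_mem[[_ th] _] := valP h.
  by rewrite -{1}th -[LHS]/(tau (\val h) o o) tauE.
rewrite /short_vec addrC brack_diag_linear // addrC !wt_sym.
have -> : root_ij (F := F) i o' h = root_ij i o h by rewrite /root_ij h0.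
move: (vm i o) (vm i o') => x y.
by rewrite scalerDr !scalerA [_ * sg k]mulrC addrC.
Qed.

(** Four positions have this weight, as both null indices have weight zero: (i, o), (i, o') and
    their images under [sigma]. The first two are related by [tau], so one entry controls all. *)
Lemma root_line_Y k i y : ~~ null i -> wt_space (part S k) (root_ij i o) y ->
  y = y i o *: Y (sg k) i.
Proof.
move=> ni wy; pose z := - y i o *: Y (sg k) i + y.
have [pz wz] : wt_space (part S k) (root_ij i o) z.
  by apply: wt_spaceZD => //; exact: wt_Y.
have zio : z i o = 0.
  rewrite -[LHS]/(- y i o * Y (sg k) i i o + y i o : F).
  by rewrite Y_id // mulr1 addNr.
suff z0 : z = 0.
  by move/eqP: z0; rewrite /z scaleNr addrC subr_eq0 => /eqP.
have /oB2_partE[[_ sz] tz] := pz.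
have zio' : z i o' = 0.
  have := congr1 (fun m : mat F K => m i o') tz; rewrite tauE swap_nonnull //.
  rewrite [z i _]zio -[(_ *: z) _ _]/(sg k * z i o' : F) => e.
  by rewrite -[LHS]mul1r -(sgK F k) -mulrA -e mulr0.
have zo a : z i (opp a) = 0 -> z a (opp i) = 0.
  by move=> e; rewrite -sz sigmaE oppK e mulr0 oppr0.
have oi : gen o i by rewrite genC gen_null.
apply: mat_ext => a b; apply/eqP; apply: contraT => zab.
case: (root_supp char0 ni oi wz zab) => -[ea h]; move: zab; rewrite ea.
  case: h => [->|[/null_cases[] -> _]]; by rewrite ?zio ?zio' eqxx.
by case: h => [->|[/null_cases[] -> _]]; rewrite zo ?eqxx.
Qed.

Lemma Delta_Y i : ~~ null i -> Delta (root_ij (F := F) i o).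
Proof.
move=> ni; apply: (root_ij_Delta (k := 0) (x := Y (sg 0) i)) => //.
- by rewrite genC gen_null.
- apply/eqP => /(congr1 (fun m : mat F K => m i o)).
  by rewrite Y_id // => /eqP; rewrite oner_eq0.
- exact: wt_Y.
Qed.

Lemma tsym_munit s a b : tsym s (e_ a b) = vm a b + s *: vm (swap_j0 a) (swap_j0 b).
Proof. by rewrite /tsym tau_vm. Qed.

(** All degrees 0 give the antisymmetry under [opp], and [k = m = 0] shows that the part depending
    on the degree is the same for all [i]. It is additive in three degrees with [k + m] even;
    setting one of them to 0 covers every parity of the other two. *)
Lemma cocycle_even (c : K -> int -> F) :
  (forall i l k m q, ~~ null i -> ~~ null l -> gen i l -> (2 %| k + m)%Z ->
     c i (k + m + q) = c i k + c (opp l) m + c l q) ->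
  exists r : F, forall i, ~~ null i ->
    (forall k, c i k = c i 0 + r * k%:~R) /\ c (opp i) 0 = - c i 0.
Proof.
move=> h; have fresh (A : seq K) := @fresh_index I B2 Iinf A.
have c0 l : ~~ null l -> c (opp l) 0 = - c l 0.
  move=> nl; have [i [ni il]] := fresh [:: l].
  have := h i l 0 0 0 ni nl (il l (mem_head _ _)) isT.
  rewrite !addr0 -addrA => e; apply/eqP; rewrite -addr_eq0; apply/eqP.
  by apply: (addrI (c i 0)); rewrite -e addr0.
pose f i k := c i k - c i 0.
have fE i l k : ~~ null i -> ~~ null l -> f i k = f l k.
  have gE i' l' : ~~ null i' -> ~~ null l' -> gen i' l' -> f i' k = f l' k.
    move=> ni nl il; have := h i' l' 0 0 k ni nl il isT.
    by rewrite c0 // !add0r /f => ->; ring.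
  move=> ni nl; have [r [nr hr]] := fresh [:: i; l].
  have ri : gen r i by apply: hr; rewrite mem_head.
  have rl : gen r l by apply: hr; rewrite !inE eqxx orbT.
  by rewrite -(gE r i) // (gE r l).
have [r [nr _]] := fresh [::]; have [l [nl hl]] := fresh [:: r].
have rl : gen r l by rewrite genC; apply: hl; exact: mem_head.
have nol : ~~ null (opp l) by rewrite null_index_opp.
have fD3 k m q : (2 %| k + m)%Z -> f r (k + m + q) = f r k + f r m + f r q.
  move=> km; rewrite {1}/f (h r l) // (fE r (opp l) m) // (fE r l q) // /f c0 //.
  by ring.
have f0 : f r 0 = 0 by rewrite /f subrr.
have fD k m : f r (k + m) = f r k + f r m.
  have [k2|k2] := boolP (2 %| k)%Z.
    by have := fD3 k 0 m; rewrite !addr0 f0 addr0; apply.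
  have [m2|m2] := boolP (2 %| m)%Z.
    by have := fD3 m 0 k; rewrite !addr0 f0 addr0 addrC [f r m + _]addrC; apply.
  by have := fD3 k m 0; rewrite !addr0 f0 addr0; apply; lia.
exists (f r 1) => i ni; split; last exact: c0.
by move=> k; rewrite -(additive_int fD) -(fE i) // /f; ring.
Qed.

(** The hypothesis links pairs (i, k) of opposite parity. For even [k] the path to (r, 0) goes
    through (l, 1), for odd [k] through (l, 0) and (q, 1). *)
Lemma cocycle_odd (c : K -> int -> F) :
  (forall i l k m, ~~ null i -> ~~ null l -> gen i l -> ~~ (2 %| k + m)%Z ->
     c i k = c l m) ->
  exists c0, forall i k, ~~ null i -> c i k = c0.
Proof.
move=> h; have fresh (A : seq K) := @fresh_index I B2 Iinf A.
have [r [nr _]] := fresh [::]; exists (c r 0) => i k ni.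
have [l [nl hl]] := fresh [:: i; r].
have li : gen l i by apply: hl; rewrite mem_head.
have lr : gen l r by apply: hl; rewrite !inE eqxx orbT.
have [k2|k2] := boolP (2 %| k)%Z.
  rewrite -(h l i 1 k) //; last by lia.
  by rewrite (h l r 1 0).
have [q [nq hq]] := fresh [:: l; r].
have ql : gen q l by apply: hq; rewrite mem_head.
have qr : gen q r by apply: hq; rewrite !inE eqxx orbT.
rewrite -(h l i 0 k) //; last by lia.
by rewrite -(h q l 1 0) // (h q r 1 0).
Qed.

Section Derivation.
Variables (n : int) (d : twisted_loop S -> twisted_loop S).
Hypothesis Dd : Der0 n d.
Local Notation sends := (@sends F _ S d n).

Lemma Y_coefs : exists c : K -> int -> F, forall i k, ~~ null i ->
  sends k (Y (sg k) i) (c i k *: Y (sg (k + n)) i).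
Proof.
have h (v : K * int) : exists c, let: (i, k) := v in ~~ null i ->
    sends k (Y (sg k) i) (c *: Y (sg (k + n)) i).
  case: v => [i k]; have [ni|ni] := boolP (null i); first by exists 0.
  have [y wy sy] := sends_root Dd (Delta_Y ni) (wt_Y k ni).
  by exists (y i o) => _; rewrite -root_line_Y.
have [c hc] := choice h; exists (fun i k => c (i, k)) => i k.
exact: (hc (i, k)).
Qed.

Variable c : K -> int -> F.
Hypothesis cE : forall i k, ~~ null i ->
  sends k (Y (sg k) i) (c i k *: Y (sg (k + n)) i).

(** The factor [sg k + sg m] is not divided out: for even [n] it is used when nonzero, for odd [n]
    when it is zero and forces the image to vanish. *)
Lemma Y_coefs_brack i l k m : ~~ null i -> ~~ null l -> gen i l ->
  sends (k + m) (- (sg k + sg m) *: vm i l)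
    (- (c i k * (sg (k + n) + sg m) + c (opp l) m * (sg k + sg (m + n))) *: vm i l).
Proof.
move=> ni nl il; have [dl _] := Dd.
have nol : ~~ null (opp l) by rewrite null_index_opp.
have /andP[/negPf neil _] := il.
have YY s t : brack (Y s i) (Y t (opp l)) = - (s + t) *: vm i l.
  by rewrite brack_YY // eq_sym neil mul0r scale0r addr0.
have := sends_brack dl (cE k ni) (cE m nol).
rewrite brackZl ?brackZr ?YY; try exact: fin_Y.
by rewrite !scalerA -scalerDl !mulrN -opprD.
Qed.

(** The short vectors of weights eps_i and -eps_l in degrees of equal parity bracket to a nonzero
    multiple of [vm i l], and a further bracket with the one of weight eps_l returns to weight
    eps_i. *)
Lemma Y_coefs_even i l k m q : (2 %| n)%Z -> ~~ null i -> ~~ null l ->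
  gen i l -> (2 %| k + m)%Z -> c i (k + m + q) = c i k + c (opp l) m + c l q.
Proof.
move=> n2 ni nl il km2; have [dl _] := Dd.
have sgn k' : sg (k' + n) = sg k' by rewrite sgD [sg n]/parity_sign n2 mulr1.
have sgm : sg m = sg k.
  have : sg (k + m) = 1 by rewrite /parity_sign km2.
  by rewrite sgD => e; rewrite -[LHS]mul1r -(sgK F k) -mulrA e mulr1.
have t0 : - (sg k + sg k) != 0.
  rewrite oppr_eq0 -mulr2n -mulr_natr mulf_neq0 //; last exact: (natr_neq0 char0 1).
  apply/eqP => e; have := sgK F k; rewrite e mul0r => /eqP.
  by rewrite eq_sym oner_eq0.
have sv : sends (k + m) (vm i l) ((c i k + c (opp l) m) *: vm i l).
  have := sendsZD dl (- (sg k + sg k))^-1 (Y_coefs_brack k m ni nl il)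
    (sends0 dl n _).
  rewrite !addr0 !sgn sgm !scalerA mulVf // scale1r -mulrDl -mulrN mulrCA mulVf //.
  by rewrite mulr1.
have := sends_brack dl sv (cE q nl).
rewrite brackZl ?brackZr ?brack_vmY //; try exact: fin_Y; try exact: fin_vm.
have sgq : sg (k + m + q) = sg q by rewrite sgD [sg (k + m)]/parity_sign km2 mul1r.
rewrite sgn -scalerDl => h; have := cE (k + m + q) ni; rewrite sgn sgq => h'.
have := sends_inj h' h => /(congr1 (fun x : mat F K => x i o)).
rewrite -[LHS]/(c i (k + m + q) * Y (sg q) i i o : F).
rewrite -[RHS]/((c i k + c (opp l) m + c l q) * Y (sg q) i i o : F).
by rewrite Y_id // !mulr1.
Qed.

(** The short vectors of weights eps_i and eps_l bracket to 0 here, while the derivation makes it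
    [2 * sg k * (c i k - c l m)] times a nonzero vector. *)
Lemma Y_coefs_odd i l k m : ~~ (2 %| n)%Z -> ~~ null i -> ~~ null l ->
  gen i l -> ~~ (2 %| k + m)%Z -> c i k = c l m.
Proof.
move=> n2 ni nl il km2; have [dl _] := Dd.
have sgn k' : sg (k' + n) = - sg k'.
  by rewrite sgD [sg n]/parity_sign (negPf n2) mulrN1.
have sgm : sg m = - sg k.
  have : sg (k + m) = - 1 by rewrite /parity_sign (negPf km2).
  by rewrite sgD => e; rewrite -[LHS]mul1r -(sgK F k) -mulrA e mulrN1.
have t0 : sg k + sg k != 0.
  rewrite -mulr2n -mulr_natr mulf_neq0 //; last exact: (natr_neq0 char0 1).
  apply/eqP => e; have := sgK F k; rewrite e mul0r => /eqP.
  by rewrite eq_sym oner_eq0.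
have nol : ~~ null (opp l) by rewrite null_index_opp.
have iol : gen i (opp l) by rewrite gen_oppr.
have := Y_coefs_brack k m ni nol iol; rewrite !sgn sgm subrr oppr0 scale0r oppK.
move=> h; have := sends_inj h (sends0 dl n _).
move=> /(congr1 (fun x : mat F K => x i (opp l))).
rewrite -[LHS]/(- (c i k * (- sg k - sg k) + c l m * (sg k - - sg k)) *
  vm i (opp l) i (opp l) : F) vm_id // mulr1 => e.
apply/eqP; rewrite -subr_eq0 -(mulIr_eq0 _ (mulIf t0)); apply/eqP.
by rewrite -[RHS]e; ring.
Qed.

End Derivation.

Lemma adapted_B n (p : mat F K) (r : F) : diagonal p -> sigma p = p ->
  tau p = sg n *: p -> r = 0 \/ (2 %| n)%Z -> adapted S n p r.
Proof.
move=> dp sp tp rn; split=> // x [[fx _] sx]; split; last first.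
  by rewrite sigma_brack sp sx.
split; first exact: fin_brack_diag.
by apply: fsbig1 => i _; rewrite brack_diagE // subrr mul0r.
Qed.

Lemma acts_as_B n (d : twisted_loop S -> twisted_loop S) (p : mat F K) (r : F) :
  Der d -> diagonal p ->
  (forall i k, ~~ null i -> acts_as d n p r k (Y (sg k) i)) ->
  (fun X => loop_val (d X)) = on_L S (loop_op n p r).
Proof.
move=> dl dp hY.
have actsZ k s x : acts_as d n p r k x -> acts_as d n p r k (s *: x).
  move=> hx; rewrite -[s *: x]addr0; apply: (acts_asZD dl) => //.
  exact: (acts_as0 dl).
(* The second factor is taken in degree 0, so one formula serves both parities of [k]. *)
have YY k i l : ~~ null i -> ~~ null l -> acts_as d n p r k
    (- (sg k + 1) *: vm i l + ((l == i)%:R * (1 - sg k)) *: vm o o).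
  move=> ni nl; have nol : ~~ null (opp l) by rewrite null_index_opp.
  rewrite -brack_YY // -[k in acts_as _ _ _ _ k]addr0 -[1](sg0 F).
  by apply: (acts_as_brack alg_fin dl) => //; apply: hY.
have null_diag k a l : ~~ null l -> null a -> acts_as d n p r k
    (tsym (sg k) (e_ a a - e_ l l)).
  move=> nl na; have nol : ~~ null (opp l) by rewrite null_index_opp.
  have vo : vm o' o' = - vm o o := vm_opp o o.
  rewrite addrC -scaleN1r tsymZD !tsym_munit (swap_nonnull nl).
  have [->|->] := null_cases na.
    have := YY k l l nl nl; rewrite eqxx mul1r (_ : swap_j0 o = o') // vo.
    move: (vm l l) (vm o o) => x y; congr acts_as; apply: mat_ext => i j.
    rewrite -[LHS]/(- (sg k + 1) * x i j + (1 - sg k) * y i j : F).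
    rewrite -[RHS]/(- 1 * (x i j + sg k * x i j) + (y i j + sg k * - y i j) : F).
    by ring.
  have := actsZ k (- 1) _ (YY k (opp l) (opp l) nol nol).
  rewrite eqxx mul1r vm_opp (_ : swap_j0 o' = o) // vo.
  move: (vm l l) (vm o o) => x y; congr acts_as; apply: mat_ext => i j.
  rewrite -[LHS]/(- 1 * (- (sg k + 1) * - x i j + (1 - sg k) * y i j) : F).
  rewrite -[RHS]/(- 1 * (x i j + sg k * x i j) + (- y i j + sg k * y i j) : F).
  by ring.
have off_diag k a b : ~~ null a -> a != b ->
    acts_as d n p r k (tsym (sg k) (e_ a b)).
  move=> na ab; have [abg|] := boolP (gen a b); last first.
    rewrite /generic ab negbK => /eqP aob.
    have -> : b = opp a by rewrite aob oppK.
    rewrite /tsym vm_anti tau0 scaler0 addr0; exact: (acts_as0 dl).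
  have [nb|nb] := boolP (null b).
    have [->|->] := null_cases nb; first by rewrite tsym_Y //; exact: hY.
    have := actsZ k (sg k) _ (hY a k na); congr acts_as.
    rewrite tsym_munit (swap_nonnull na) (_ : swap_j0 o' = o) // /short_vec.
    move: (vm a o) (vm a o') => x y.
    by rewrite scalerDr scalerA sgK scale1r addrC.
  have := actsZ k (- 1) _ (YY k a b na nb).
  rewrite eq_sym (negPf ab) mul0r scale0r addr0; congr acts_as.
  rewrite tsym_munit !swap_nonnull //; move: (vm a b) => x.
  by rewrite scalerA mulrNN mul1r scalerDl scale1r addrC.
have acts_tsym k x : sl x -> acts_as d n p r k (tsym (sg k) x).
  move: x; apply: sl_ind.
  - by rewrite tsym0; exact: (acts_as0 dl).
  - by move=> s x y hx hy; rewrite tsymZD; apply: (acts_asZD dl).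
  - move=> a b ab; have [na|na] := boolP (null a); last exact: off_diag.
    have [nb|nb] := boolP (null b).
      have -> : b = opp a.
        by case: (null_cases na) (null_cases nb) ab => -> [] ->; rewrite ?eqxx.
      rewrite /tsym vm_anti tau0 scaler0 addr0; exact: (acts_as0 dl).
    have nob : ~~ null (opp b) by rewrite null_index_opp.
    (* With [a] null and [b] not, the opposite pair gives the same vector up to sign and has its
       null index in second place. *)
    have oba : opp b != opp a by rewrite (inj_eq (can_inj oppK)) eq_sym.
    have := actsZ k (- 1) _ (off_diag k _ _ nob oba); congr acts_as.
    rewrite /tsym vm_opp; move: (vm a b) => x.
    have -> : tau (- x) = - tau x by rewrite -!scaleN1r tauZ.
    by rewrite scaleN1r scalerN opprD !opprK.
  - move=> A; have [l [nl hl]] := @fresh_index I B2 Iinf A; exists l => a aA.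
    have [na|na] := boolP (null a); first exact: null_diag.
    (* The brackets of short vectors give diagonal differences involving a null index, so the
       difference is routed through [o]. *)
    have -> : e_ a a - e_ l l = (- 1) *: (e_ o o - e_ a a) + (e_ o o - e_ l l).
      by rewrite scaleN1r opprB addrA subrK.
    by rewrite tsymZD; apply: (acts_asZD dl) => //; exact: null_diag.
apply: (acts_as_op dl) => // k x /oB2_partE[[sx ex] tx].
have two : (1 + 1) * (1 + 1) != 0 :> F.
  by rewrite mulf_neq0 //; exact: (natr_neq0 char0 1).
have e4 : tsym (sg k) x = ((1 + 1) * (1 + 1)) *: x.
  have xx : x + x = (1 + 1) *: x by rewrite scalerDl scale1r.
  rewrite /tsym /sym ex scale1r xx tauZ tx !scalerA mulrAC sgK mul1r -scalerDl.
  by congr (_ *: _); ring.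
have -> : x = ((1 + 1) * (1 + 1))^-1 *: tsym (sg k) x.
  by rewrite e4 scalerA mulVf // scale1r.
by apply: (actsZ); exact: acts_tsym.
Qed.

Lemma DerL_B_even n D : (2 %| n)%Z -> DerL S n D -> exists (p : mat F K) (r : F),
  [/\ diagonal p, sigma p = p, tau p = p & D = on_L S (loop_op n p r)].
Proof.
move=> n2 [d Dd <-]; have [c cE] := Y_coefs Dd; have [dl _] := Dd.
have [r hr] := cocycle_even
  (fun i l k m q => @Y_coefs_even n d Dd c cE i l k m q n2).
(* At the null indices [p] must be 0: [tau] requires equal values at [o] and [o'], and [sigma]
   opposite ones. *)
pose p i : F := if null i then 0 else c i 0.
have pp i : p (opp i) = - (1 * p i).
  rewrite /p null_index_opp; case: ifP => [_|/negbT /hr[_ ->]];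
    by rewrite mul1r ?oppr0.
have sn k : sg (k + n) = sg k by rewrite sgD [sg n]/parity_sign n2 mulr1.
have dp := @diagm_diagonal F I B2 p; have sp := sigma_diagm pp.
exists (diagm p), r; split=> //; first by rewrite sp scale1r.
  apply: mat_ext => i j; rewrite tauE /diagm (inj_eq (can_inj (@swap_j0K I))).
  case: eqP => // _; rewrite /p.
  have [/null_cases[] ->|ni] := boolP (null i) => //.
  by rewrite swap_nonnull // (negPf ni).
apply: (acts_as_B dl) => // i k ni; rewrite /acts_as.
have := cE i k ni; rewrite sn; congr sends.
have bE j : null j -> brack (diagm p) (vm i j) = c i 0 *: vm i j.
  move=> nj; rewrite (brack_diag_sym _ _ dp (mulr1 1) sp) mulr1.
  by rewrite brack_diag_munit // !diagmE symZ /p nj (negPf ni) subr0.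
have [ck _] := hr i ni; rewrite [c i k]ck scalerDl; congr (_ + _).
rewrite /short_vec addrC brack_diag_linear // !bE //.
move: (vm i o) (vm i o') => x y.
by rewrite scalerDr !scalerA mulrC.
Qed.

Lemma DerL_B_odd n D : ~~ (2 %| n)%Z -> DerL S n D ->
  exists c : F, D = on_L S (loop_op n (c *: (e_ o o - e_ o' o')) 0).
Proof.
move=> n2 [d Dd <-]; have [c cE] := Y_coefs Dd; have [dl _] := Dd.
have [r hr] := cocycle_odd
  (fun i l k m => @Y_coefs_odd n d Dd c cE i l k m n2).
(* Since [p] vanishes at [i], it acts on [vm i o] by minus its entry at [o], whence the sign; the
   opposite entry at [o'] turns the sign [sg k] of the short vector into [sg (k + n)]. *)
exists (- r); set p := - r *: _.
have pE i j : p i j =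
    - r * (((i == o) && (j == o))%:R - ((i == o') && (j == o'))%:R) by [].
have dp : diagonal p.
  move=> i j ij; rewrite pE.
  have E v : (i == v) && (j == v) = false.
    by apply: contraNF ij => /andP[/eqP -> /eqP ->].
  by rewrite !E subrr mulr0.
have sp : sigma p = 1 *: p.
  by rewrite /p sigmaZ (sigma_coroot F o) scale1r.
have sn k : sg (k + n) = - sg k by rewrite sgD [sg n]/parity_sign (negPf n2) mulrN1.
apply: (acts_as_B dl) => // i k ni; rewrite /acts_as mul0r scale0r addr0.
have := cE i k ni; rewrite sn hr //; congr sends.
have bE j : brack p (vm i j) = - p j j *: vm i j.
  rewrite (brack_diag_sym _ _ dp (mulr1 1) sp) mulr1.
  rewrite brack_diag_munit // symZ; congr (_ *: _).
  have [/negPf io /negPf io'] : i != o /\ i != o'.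
    by split; apply: contraNneq ni => ->.
  by rewrite pE io io' subrr mulr0 sub0r.
rewrite /short_vec [vm i o + sg k *: _]addrC brack_diag_linear // !bE !pE !eqxx.
move: (vm i o) (vm i o') => x y; apply: mat_ext => a b.
rewrite -[LHS]/(r * (x a b + - sg k * y a b) : F).
rewrite -[RHS]/(sg k * (- (- r * (0 - 1)) * y a b) +
  - (- r * (1 - 0)) * x a b : F).
by ring.
Qed.

End TypeB.

(** * Homogeneous derivations *)

Section Characterization.
Variables (F : fieldType) (I : choiceType) (ty : twisted_type).
Hypothesis char0 : [pchar F] =i pred0.
Hypothesis Iinf : infinite_set [set: I].
Local Notation K := (tw_index I ty).
Local Notation S := (twisted_pair F I ty).
Implicit Types (p x : mat F K) (r : F) (k m n : int).

Lemma sg_even n : (2 %| n)%Z -> parity_sign F n = 1.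
Proof. by rewrite /parity_sign => ->. Qed.

Lemma sg_odd n : ~~ (2 %| n)%Z -> parity_sign F n = - 1.
Proof. by rewrite /parity_sign => /negPf ->. Qed.

Lemma Pdiag_diagonal p : Pdiag F I ty p -> diagonal p.
Proof. by case: ty p => p []. Qed.

Lemma adapted_Pdiag n p r : (2 %| n)%Z -> Pdiag F I ty p -> adapted S n p r.
Proof.
move=> n2; have sn := sg_even n2.
case: ty p => p; [case=> dp sp tp|case=> dp sp|case=> dp sp].
- by apply: adapted_B; rewrite ?sn ?scale1r //; right.
- by apply: adapted_sl; rewrite ?sn ?scale1r //; right.
- by apply: adapted_sl; rewrite ?sn ?scale1r //; right.
Qed.

Lemma adapted_Tminus n p : ~~ (2 %| n)%Z -> Tminus F I ty p -> adapted S n p 0.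
Proof.
move=> n2; have sn := sg_odd n2; case: ty p => p; last 2 first.
- by case=> dp sp; apply: adapted_sl; rewrite ?sn ?scaleN1r //; left.
- by case=> dp sp; apply: adapted_sl; rewrite ?sn ?scaleN1r //; left.
case=> c _ <-; set q := munit F _ _ - _.
have qE i j : q i j = ((i == j0 I) && (j == j0 I))%:R -
  ((i == j0' I) && (j == j0' I))%:R by [].
apply: adapted_B; last by left.
- move=> i j ij; rewrite -[LHS]/(c * q i j : F) qE.
  have E v : (i == v) && (j == v) = false.
    by apply: contraNF ij => /andP[/eqP -> /eqP ->].
  by rewrite !E subrr mulr0.
- by rewrite sigmaZ /q (sigma_coroot F (j0 I)).
- rewrite sn tauZ scaleN1r -scalerN; congr (_ *: _).
  rewrite /q opprB -scaleN1r addrC tauZD !tau_munit /=.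
  by rewrite scaleN1r addrC.
Qed.

Lemma DerL_even n : (2 %| n)%Z -> DerL S n =
  [set on_L S (loop_op n p r) | p in Pdiag F I ty & r in [set: F]].
Proof.
move=> n2; apply/seteqP; split; last first.
  move=> _ [p Pp [r _ <-]]; apply: adapted_Der0.
    exact: twisted_alg_fin.
  exact: adapted_Pdiag.
have sn := sg_even n2; move=> D; case: ty D => D hD.
- have [p [r [dp sp tp ->]]] := DerL_B_even char0 Iinf n2 hD.
  by exists p => //; exists r.
- have ne : C2 <> B2 by [].
  have [p [r [dp sp _ ->]]] := DerL_sl char0 Iinf ne hD.
  by exists p; [split=> //; rewrite sp sn scale1r|exists r].
- have ne : BC2 <> B2 by [].
  have [p [r [dp sp _ ->]]] := DerL_sl char0 Iinf ne hD.
  by exists p; [split=> //; rewrite sp sn scale1r|exists r].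
Qed.

Lemma DerL_odd n : ~~ (2 %| n)%Z -> DerL S n =
  [set on_L S (loop_op n p 0) | p in Tminus F I ty].
Proof.
move=> n2; apply/seteqP; split; last first.
  move=> _ [p Pp <-]; apply: adapted_Der0; first exact: twisted_alg_fin.
  exact: adapted_Tminus.
have sn := sg_odd n2; move=> D; case: ty D => D hD.
- have [c ->] := DerL_B_odd char0 Iinf n2 hD.
  exists (c *: (munit F (j0 I) (j0 I) - munit F (j0' I) (j0' I))) => //.
  by exists c.
- have ne : C2 <> B2 by [].
  have [p [r [dp sp [->|rn] ->]]] := DerL_sl char0 Iinf ne hD.
    by exists p => //; split=> //; rewrite sp sn scaleN1r.
  by rewrite rn in n2.
- have ne : BC2 <> B2 by [].
  have [p [r [dp sp [->|rn] ->]]] := DerL_sl char0 Iinf ne hD.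
    by exists p => //; split=> //; rewrite sp sn scaleN1r.
  by rewrite rn in n2.
Qed.

Lemma loop_op_split n p r :
  loop_op n p r = loop_shift n \o (loop_op 0 p r) :> (loop F K -> loop F K).
Proof.
apply/funext => X; apply: loop_ext => k.
by rewrite /loop_op /loop_shift /= subr0.
Qed.

Lemma on_L_loop_op0 p r :
  on_L S (loop_op 0 p r) = on_L S (loop_ad p) + r *: on_L S (@loop_deg F K).
Proof.
apply/funext => X; apply: loop_ext => k.
by rewrite /on_L /loop_op /loop_shift subr0.
Qed.

(** A coroot in degree 2 is annihilated by the diagonal [p], while the degree operator multiplies it
    by 2, which is nonzero in F. *)
Lemma loop_ad_deg0 p r : diagonal p ->
  on_L S (loop_ad p) = r *: on_L S (@loop_deg F K) -> r = 0.
Proof.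
move=> dp e; have [u [nu _]] := @fresh_index I ty Iinf [::].
have [hx dx] := cartan_coroot F nu; set x := _ - _ in hx dx.
have px : part S 2 x by [].
have := congr1 (fun f : twisted_loop S -> loop F K => f (ltens S x 2) 2) e.
rewrite -[LHS]/(brack p (loop_val (ltens S x 2) 2)).
rewrite -[RHS]/(r *: (2%:~R *: loop_val (ltens S x 2) 2)) ltensE // tensE.
move=> /(congr1 (fun m : mat F K => m u u)); rewrite brack_diagE // subrr mul0r.
rewrite -[RHS]/(r * (2%:~R * x u u) : F).
have -> : x u u = 1.
  rewrite -[LHS]/(munit F u u u u - munit F (opp_index u) (opp_index u) u u : F).
  by rewrite /munit !eqxx eq_sym (negPf (opp_index_neq nu)) subr0.
by move/esym/eqP; rewrite mulr1 mulf_eq0 (negPf (natr_neq0 char0 1)) orbF => /eqP.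
Qed.

End Characterization.

Theorem theorem8p10 (F : fieldType) (char0 : [pchar F] =i pred0)
    (I : choiceType) (Iinf : infinite_set [set: I]) (ty : twisted_type) :
  let S := twisted_pair F I ty in
  let adP := [set on_L S (loop_ad p) | p in Pdiag F I ty] in
  let Fd0 := [set c *: on_L S (@loop_deg F (tw_index I ty))
             | c in [set: F]] in
  [/\ DerL S 0 = [set a + b | a in adP & b in Fd0],
      adP `&` Fd0 = [set 0],
      forall m : int,
        DerL S (2 * m) = [set loop_shift (2 * m) \o D | D in DerL S 0]
    & forall m : int,
        DerL S (2 * m + 1) =
        [set on_L S (loop_shift (2 * m + 1) \o loop_ad p)
        | p in Tminus F I ty]].
Proof.
move=> S adP Fd0.
have even0 : (2 %| 0)%Z by [].
split.
- rewrite (DerL_even _ char0 Iinf even0); apply/seteqP; split.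
    move=> _ [p Pp [r _ <-]]; exists (on_L S (loop_ad p)); first by exists p.
    exists (r *: on_L S (@loop_deg F (tw_index I ty))); first by exists r.
    by rewrite on_L_loop_op0.
  move=> _ [_ [p Pp <-] [_ [r _ <-] <-]]; exists p => //; exists r => //.
  exact: on_L_loop_op0.
- apply/seteqP; split.
    move=> _ [[p Pp <-] [r _ e]]; rewrite /= -e.
    by rewrite (loop_ad_deg0 char0 Iinf (Pdiag_diagonal Pp) (esym e)) scale0r.
  move=> _ ->; split; last by exists 0; rewrite ?scale0r.
  exists 0.
    have z0 : diagonal (0 : mat F (tw_index I ty)) by [].
    have s0 := @sigma0 F I ty.
    by case: {S adP Fd0} ty z0 s0 => // z0 s0; split=> //; rewrite ?s0 ?oppr0 ?tau0.
  apply/funext => X; apply: loop_ext => k; exact: brack0l.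
- move=> m; have even_m : (2 %| 2 * m)%Z by lia.
  rewrite (DerL_even _ char0 Iinf even_m) (DerL_even _ char0 Iinf even0).
  apply/seteqP; split.
    move=> _ [p Pp [r _ <-]]; exists (on_L S (loop_op 0 p r)).
      by exists p => //; exists r.
    by rewrite [loop_op (2 * m) p r]loop_op_split.
  move=> _ [_ [p Pp [r _ <-]] <-]; exists p => //; exists r => //.
  by rewrite [loop_op (2 * m) p r]loop_op_split.
- move=> m; have odd_m : ~~ (2 %| 2 * m + 1)%Z by lia.
  have opE p : on_L S (loop_op (2 * m + 1) p 0) =
      on_L S (loop_shift (2 * m + 1) \o loop_ad p).
    apply/funext => X; apply: loop_ext => k.
    by rewrite /on_L loop_opE mul0r scale0r addr0.
  rewrite (DerL_odd _ char0 Iinf odd_m).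
  by apply/seteqP; split=> _ [p Tp <-]; exists p => //; rewrite opE.
Qed.
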